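(* Let $p$ and $q$ be two distributions on $[k]$ and let $\epsilon>0$. Then the sample complexity behaves as $$n^*(p,q,\epsilon)\lesssim\begin{cases}\dfrac{1}{\epsilon^2\, d_{\mathrm{TV}}^2(p,q)}, & \text{if } \epsilon\le 1,\\[2mm] \min\left(\dfrac{1}{d_{\mathrm{TV}}^2(p,q)},\dfrac{\alpha^2}{e^\epsilon\, d_{\mathrm h}^4(p,q)}\right), & \text{if } e^\epsilon\in\left(e,\dfrac{\alpha}{d_{\mathrm h}^2(p,q)}\right],\\[2mm] \dfrac{\alpha}{d_{\mathrm h}^2(p,q)}, & \text{if } e^\epsilon>\dfrac{\alpha}{d_{\mathrm h}^2(p,q)},\end{cases}$$ where the cases are read in order (the first applicable case is used), and where $\alpha\lesssim\log\left(1/d_{\mathrm h}^2(p,q)\right)\asymp\log\left(n^*(p,q)\right)$. Moreover, the rates on the right-hand side of this bound are achieved by an $\epsilon$-LDP channel $\mathbf T$ that maps $[k]$ to $[2]$ (all users employing the same channel $\mathbf T$) and that can be found in time polynomial in $k$, for any choice of $p$, $q$, and $\epsilon$.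
   Context: $[k]=\{1,\dots,k\}$. $d_{\mathrm{TV}}(p,q)=\frac12\sum_i|p_i-q_i|$, $d_{\mathrm h}^2(p,q)=\sum_i(\sqrt{p_i}-\sqrt{q_i})^2$, and $d_{\mathrm h}^4=(d_{\mathrm h}^2)^2$. The notations $\lesssim,\asymp$ hide universal positive constants. A channel $\mathbf T$ from $\mathcal X$ to a countable set $\mathcal Y$ is a transition kernel $\mathbf T(y,x)=\mathbb P(Y=y\mid X=x)$, also viewed as a stochastic map $Y=\mathbf T(X)$. It is $\epsilon$-LDP if $\mathbf T(y,x)\le e^\epsilon\,\mathbf T(y,x')$ for all $x,x'\in\mathcal X$, $y\in\mathcal Y$. Sample complexity $n^*(p,q,\epsilon)$: the smallest $n$ for which there exist a deterministic rule assigning to each user $i\in[n]$ an $\epsilon$-LDP channel $\mathbf T_i$ from $\mathcal X$ to $\mathbb N$, and a test $\phi$ with values in $\{p,q\}$, such that, when $X_1,\dots,X_n$ are i.i.d. and $Y_i=\mathbf T_i(X_i)$ are generated independently, $$\mathbb P_{(X_1,\dots,X_n)\sim p^{\otimes n}}(\phi(Y_1,\dots,Y_n)\ne p)+\mathbb P_{(X_1,\dots,X_n)\sim q^{\otimes n}}(\phi(Y_1,\dots,Y_n)\ne q)\le 0.1.$$ $n^*(p,q)$ is the same quantity with no privacy constraint (all channels allowed, $\epsilon=\infty$). A rate is achieved by a channel $\mathbf T$ if the inequality $\mathbb P_{(X_1,\dots,X_n)\sim p^{\otimes n}}(\phi(Y_1,\dots,Y_n)\ne p)+\mathbb P_{(X_1,\dots,X_n)\sim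 q^{\otimes n}}(\phi(Y_1,\dots,Y_n)\ne q)\le 0.1$ holds for some test $\phi$ with $\mathbf T_i=\mathbf T$ for all $i$ and $n$ bounded by a universal constant times that rate.
   Formalization: p and q are assumed distinct, and the logarithms in α ≲ log(1/d_h²) ≍ log n*(p,q) are read as max(1, log), since log(1/d_h²) ≤ 0 when d_h² ≥ 1 makes the literal bound false; the bare logarithms are used when d_h² ≤ 1/2. *)

(* Defs.v *)
From HB Require Import structures.
From mathcomp Require Import all_boot all_order all_algebra.
From mathcomp Require Import all_classical all_reals all_analysis.

Set Implicit Arguments.
Unset Strict Implicit.
Unset Printing Implicit Defensive.

Import Order.TTheory GRing.Theory Num.Theory.

Local Open Scope classical_set_scope.
Local Open Scope ring_scope.

Section Distances.
Context {R : realType} {k : nat}.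
Implicit Types p q : 'I_k -> R.

Definition is_dist p : Prop := (forall i, 0 <= p i) /\ \sum_(i < k) p i = 1.

Definition dTV p q : R := 2^-1 * \sum_(i < k) `|p i - q i|.

(* This is the squared distance [d_h^2], without a factor [1/2]; it ranges
   over [[0, 2]]. *)
Definition dH2 p q : R :=
  \sum_(i < k) (Num.sqrt (p i) - Num.sqrt (q i)) ^+ 2.

End Distances.

(* The logarithm as it is understood under [\lesssim] and [\asymp], that is,
   bounded below by a positive constant. *)
Definition lnp {R : realType} (x : R) : R := Num.max 1 (ln x).

Section Channels.
Context {R : realType}.

(* [T x y] is the probability of the output [y] on the input [x]. *)
Definition is_channel (X : Type) (Y : countType) (T : X -> Y -> R) : Prop :=
  (forall x y, 0 <= T x y) /\
  (forall x, \esum_(y in [set: Y]) (T x y)%:E = 1%E).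

Definition LDP (X : Type) (Y : countType) (eps : R) (T : X -> Y -> R) : Prop :=
  forall x x' y, T x y <= expR eps * T x' y.

(* The probability that [(Y_1, ..., Y_n)] is in [A] when the [X_i] are i.i.d.
   with law [p] and [Y_i = T_i(X_i)], independently: the pair of [x] and [y]
   has mass [\prod_i p(x_i) T_i(y_i | x_i)]. *)
Definition output_prob (k n : nat) (Y : countType) (p : 'I_k -> R)
    (T : 'I_n -> 'I_k -> Y -> R) (A : set {ffun 'I_n -> Y}) : \bar R :=
  \esum_(y in A)
    (\sum_(x : {ffun 'I_n -> 'I_k}) \prod_(i < n) (p (x i) * T i (x i) (y i)))%:E.

(* A test answers [true] for [p] and [false] for [q]. *)
Definition succeeds (k n : nat) (Y : countType) (p q : 'I_k -> R)
    (T : 'I_n -> 'I_k -> Y -> R) (phi : {ffun 'I_n -> Y} -> bool) : Prop :=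
  (output_prob p T [set y | phi y != true] +
   output_prob q T [set y | phi y != false] <= (10^-1)%:E)%E.

Definition testable (k : nat) (p q : 'I_k -> R)
    (allowed : set ('I_k -> nat -> R)) (n : nat) : Prop :=
  exists T : 'I_n -> 'I_k -> nat -> R,
    (forall i, is_channel (T i) /\ allowed (T i)) /\
    exists phi : {ffun 'I_n -> nat} -> bool, succeeds p q T phi.

Definition is_sample_complexity (k : nat) (p q : 'I_k -> R)
    (allowed : set ('I_k -> nat -> R)) (n : nat) : Prop :=
  testable p q allowed n /\ forall m, testable p q allowed m -> (n <= m)%N.

Definition achieves (k : nat) (Y : countType) (p q : 'I_k -> R)
    (T : 'I_k -> Y -> R) (r : R) : Prop :=
  exists (n : nat) (phi : {ffun 'I_n -> Y} -> bool),
    n%:R <= r /\ succeeds p q (fun _ : 'I_n => T) phi.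

Definition ldp_rate (k : nat) (p q : 'I_k -> R) (alpha eps : R) : R :=
  if eps <= 1 then 1 / (eps ^+ 2 * dTV p q ^+ 2)
  else if expR 1 < expR eps <= alpha / dH2 p q then
    Num.min (1 / dTV p q ^+ 2) (alpha ^+ 2 / (expR eps * dH2 p q ^+ 2))
  else alpha / dH2 p q.

End Channels.

(* The model of computation: a real RAM, with exact real arithmetic extended by
   square root and exponential, at unit cost.  Programs are uniform: they are
   finite terms that mention no real constant but the naturals.  There is no
   rounding of reals to naturals, and the only arithmetic on naturals (used for
   loop counters and for addressing arrays) is the successor.  An instruction
   costs one step whatever its expressions, whose size does not depend on the
   input. *)
Inductive nexp : Type :=
  | NConst of nat
  | NVar of nat
  | NSucc of nexp.

Inductive rexp : Type :=
  | RConst of nat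
  | RGet of nat & nexp  (* array, index *)
  | RAdd of rexp & rexp
  | RSub of rexp & rexp
  | RMul of rexp & rexp
  | RDiv of rexp & rexp
  | RSqrt of rexp
  | RExp of rexp.

Inductive bexp : Type :=
  | NLt of nexp & nexp
  | RLe of rexp & rexp.

Inductive cmd : Type :=
  | Skip
  | NSet of nat & nexp
  | RSet of nat & nexp & rexp
  | Seq of cmd & cmd
  | If of bexp & cmd & cmd
  | While of bexp & cmd.

Section RealRAM.
Context {R : realType}.

Record store : Type := Store { nvar : nat -> nat; rarr : nat -> nat -> R }.

Fixpoint neval (s : store) (e : nexp) : nat :=
  match e with
  | NConst n => n
  | NVar v => nvar s v
  | NSucc e => (neval s e).+1
  end.

Fixpoint reval (s : store) (e : rexp) : R :=
  match e with
  | RConst n => n%:R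
  | RGet a i => rarr s a (neval s i)
  | RAdd e1 e2 => reval s e1 + reval s e2
  | RSub e1 e2 => reval s e1 - reval s e2
  | RMul e1 e2 => reval s e1 * reval s e2
  | RDiv e1 e2 => reval s e1 / reval s e2
  | RSqrt e => Num.sqrt (reval s e)
  | RExp e => expR (reval s e)
  end.

Definition beval (s : store) (b : bexp) : bool :=
  match b with
  | NLt e1 e2 => (neval s e1 < neval s e2)%N
  | RLe e1 e2 => reval s e1 <= reval s e2
  end.

Definition set_nvar (s : store) (v m : nat) : store :=
  Store (fun w => if w == v then m else nvar s w) (rarr s).

Definition set_rarr (s : store) (a i : nat) (x : R) : store :=
  Store (nvar s)
    (fun b j => if (b == a) && (j == i) then x else rarr s b j).

(* [exec c s t s']: started in [s], [c] halts in [s'] after [t] steps. *)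
Inductive exec : cmd -> store -> nat -> store -> Prop :=
  | exec_skip s : exec Skip s 1 s
  | exec_nset s v e : exec (NSet v e) s 1 (set_nvar s v (neval s e))
  | exec_rset s a i e :
      exec (RSet a i e) s 1 (set_rarr s a (neval s i) (reval s e))
  | exec_seq c1 c2 s t1 s1 t2 s2 :
      exec c1 s t1 s1 -> exec c2 s1 t2 s2 -> exec (Seq c1 c2) s (t1 + t2) s2
  | exec_if b c1 c2 s t s' :
      exec (if beval s b then c1 else c2) s t s' ->
      exec (If b c1 c2) s t.+1 s'
  | exec_while_true b c s t1 s1 t2 s2 :
      beval s b -> exec c s t1 s1 -> exec (While b c) s1 t2 s2 ->
      exec (While b c) s (t1 + t2).+1 s2
  | exec_while_false b c s :
      ~~ beval s b -> exec (While b c) s 1 s.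

Definition array_of (k : nat) (p : 'I_k -> R) (i : nat) : R :=
  if insub i is Some j then p j else 0.

(* Natural variable 0 holds [k]; the arrays 0, 1, 2 hold [p], [q], [eps]; all
   the rest is zero. *)
Definition input (k : nat) (p q : 'I_k -> R) (eps : R) : store :=
  Store (fun v => if v == 0 then k else 0)%N
        (fun a i => match a with
                    | 0 => array_of p i
                    | 1 => array_of q i
                    | 2 => if i == 0%N then eps else 0
                    | _ => 0
                    end).

(* The output is the pair of arrays 3 and 4, one for each output letter. *)
Definition finds_channel (c : cmd) (k : nat) (p q : 'I_k -> R) (eps : R)
    (T : 'I_k -> 'I_2 -> R) (bound : nat) : Prop :=
  exists (t : nat) (s : store),
    [/\ exec c (input p q eps) t s, (t <= bound)%N &
        forall (x : 'I_k) (y : 'I_2), rarr s (3 + y) x = T x y].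

End RealRAM.

(* Main.v *)
(* Randomized response is applied to the indicator of a superlevel set of the
   likelihood ratio, so that the output is a pair of Bernoulli laws; the program
   tries all [k] thresholds and keeps the one that maximizes the squared
   Hellinger distance [M] of this pair.  The likelihood ratio test on [n] outputs
   has total error at most [(1 - M / 2)^n], so [18 / M] samples are enough, and it
   remains to bound [M] below.

   - The threshold 1 gives [M >= c min(1, eps)^2 dTV^2].
   - Let [w] be the Hellinger contribution of a superlevel set itself, before the
     noise.  For [eps >= 1] the noise costs only [M >= c min(w, e^eps w^2)].
   - Some threshold has [w >= dH2 / alpha]: with
     [r_i = (p_i - q_i) / (p_i + q_i)], the part of [dH2] on [p > q] is at most
     [\sum_i (p_i - q_i) r_i].  Cutting [r] at the dyadic levels [2^-j], for
     [j <= m], bounds this by [4 (m + 1) max w + 2^-m], and [2^-m] is negligible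
     for [m] of order [log (1 / dH2)].  The part on [q > p] is symmetric.

   Conversely, by data processing any test with [n] samples has total error at
   least [\sum_x min(p^n x, q^n x)], which forces [n dH2 >= 11 / 15]; together with
   the bound [1 / dTV^2 <= 4 / dH2^2] this compares [log n^*] with
   [log (1 / dH2)]. *)

Require Import Defs.
From mathcomp Require Import all_boot all_order all_algebra.
From mathcomp Require Import all_classical all_reals all_analysis.
From mathcomp Require Import ring lra zify.

Import Order.TTheory GRing.Theory Num.Theory.

Local Open Scope classical_set_scope.
Local Open Scope ring_scope.

(** * Hellinger distance and randomized response *)

Definition h2 {R : realType} (a b : R) : R := (Num.sqrt a - Num.sqrt b) ^+ 2.

Section Scalar.
Context {R : realType}.
Implicit Types a b E P Q : R.

Lemma h2_ge0 a b : 0 <= h2 a b.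
Proof. exact: sqr_ge0. Qed.

Lemma h2C a b : h2 a b = h2 b a.
Proof. by rewrite /h2 -sqrrN opprB. Qed.

(** With $a=x^2$ and $b=y^2$, $(a-b)^2=(x-y)^2(x+y)^2$ and $a+b\le(x+y)^2\le2(a+b)$; this lemma and
    [h2_ge] are the two halves. *)
Lemma h2_le a b : 0 <= a -> 0 <= b -> h2 a b * (a + b) <= (a - b) ^+ 2.
Proof.
move=> a0 b0; rewrite /h2 -{2 3}(sqr_sqrtr a0) -{2 3}(sqr_sqrtr b0).
have := sqrtr_ge0 a; have := sqrtr_ge0 b.
move: (Num.sqrt a) (Num.sqrt b) => x y y0 x0.
have -> : (x ^+ 2 - y ^+ 2) ^+ 2 = (x - y) ^+ 2 * (x + y) ^+ 2 by ring.
apply: ler_wpM2l; first exact: sqr_ge0.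
have := mulr_ge0 x0 y0; lra.
Qed.

Lemma h2_ge a b : 0 <= a -> 0 <= b -> (a - b) ^+ 2 <= 2 * (a + b) * h2 a b.
Proof.
move=> a0 b0; rewrite /h2 -{1 2}(sqr_sqrtr a0) -{1 2}(sqr_sqrtr b0).
move: (Num.sqrt a) (Num.sqrt b) => x y.
have -> : (x ^+ 2 - y ^+ 2) ^+ 2 = (x + y) ^+ 2 * (x - y) ^+ 2 by ring.
apply: ler_wpM2r; first exact: sqr_ge0.
have := sqr_ge0 (x - y); lra.
Qed.

Lemma h2_le_norm a b : 0 <= a -> 0 <= b -> h2 a b <= `|a - b|.
Proof.
move=> a0 b0; rewrite /h2 -{2}(sqr_sqrtr a0) -{2}(sqr_sqrtr b0).
have := sqrtr_ge0 a; have := sqrtr_ge0 b.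
move: (Num.sqrt a) (Num.sqrt b) => x y y0 x0.
have -> : x ^+ 2 - y ^+ 2 = (x - y) * (x + y) by ring.
rewrite normrM (ger0_norm (addr_ge0 x0 y0)) -(real_normK (num_real (x - y))) expr2.
apply: ler_wpM2l => //; rewrite ler_norml; lra.
Qed.

Lemma h2E a b : 0 <= a -> 0 <= b -> h2 a b = a + b - 2 * Num.sqrt (a * b).
Proof.
move=> a0 b0; rewrite /h2 sqrrB !sqr_sqrtr// sqrtrM//; lra.
Qed.

(* [rr_lo] and [rr_hi] are the transition probabilities of randomized response
   with [E = exp eps]. *)
Definition rr_lo E : R := 1 / (1 + E).
Definition rr_hi E : R := E / (1 + E).

(** The squared Hellinger distance between the two output laws when randomized response is applied
    to a bit of law Bernoulli($P$) or Bernoulli($Q$). The second term belongs to the other output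
    letter, because [rr_lo] and [rr_hi] add up to 1. *)
Definition score E P Q : R :=
  h2 (rr_lo E + (rr_hi E - rr_lo E) * P) (rr_lo E + (rr_hi E - rr_lo E) * Q) +
  h2 (rr_hi E - (rr_hi E - rr_lo E) * P) (rr_hi E - (rr_hi E - rr_lo E) * Q).

Lemma score_ge0 E P Q : 0 <= score E P Q.
Proof. by rewrite addr_ge0 ?h2_ge0. Qed.

Lemma score_compl E P Q : score E (1 - P) (1 - Q) = score E P Q.
Proof.
rewrite /score addrC; congr (h2 _ _ + h2 _ _); lra.
Qed.

Lemma scorexx E P : score E P P = 0.
Proof. by rewrite /score /h2 !subrr expr0n addr0. Qed.

Lemma rr_add E : 0 < E -> rr_lo E + rr_hi E = 1.
Proof. by move=> E0; rewrite /rr_lo /rr_hi; field; lra. Qed.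

Lemma rr_lo_gt0 E : 0 < E -> 0 < rr_lo E.
Proof. by move=> E0; rewrite divr_gt0//; lra. Qed.

Lemma rr_hi_gt0 E : 0 < E -> 0 < rr_hi E.
Proof. by move=> E0; rewrite divr_gt0//; lra. Qed.

Lemma rr_hiE E : 0 < E -> rr_hi E = E * rr_lo E.
Proof. by move=> E0; rewrite /rr_lo /rr_hi mul1r. Qed.

(** One output letter suffices: its two probabilities are at most 1, so the factor $2(a+b)$ of
    [h2_ge] is at most 4. *)
Lemma score_ge_tv E P Q : 1 <= E -> 0 <= P <= 1 -> 0 <= Q <= 1 ->
  ((rr_hi E - rr_lo E) * (P - Q)) ^+ 2 <= 4 * score E P Q.
Proof.
move=> E1 P01 Q01; have E0 : 0 < E by lra.
have := rr_add E E0; have := rr_hiE E E0; have := rr_lo_gt0 E E0.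
rewrite /score; move: (rr_lo E) (rr_hi E) => l h l0 hE lh.
have lh' : l <= h by rewrite hE; nra.
have := h2_ge (l + (h - l) * P) (l + (h - l) * Q).
have -> : l + (h - l) * P - (l + (h - l) * Q) = (h - l) * (P - Q) by ring.
have := h2_ge0 (l + (h - l) * P) (l + (h - l) * Q).
have := h2_ge0 (h - (h - l) * P) (h - (h - l) * Q).
move: (h2 (h - _) _) (h2 (l + _) _) => v u v0 u0 /(_ _ _)/le_trans; apply; [nra|nra|].
apply: (@le_trans _ _ (4 * u)); last lra.
apply: ler_wpM2r => //; nra.
Qed.

(** The noise floor $l$ = [rr_lo E] competes with $a+b$. If $a+b\ge2l$, the noise costs a constant
    factor. Otherwise $(a-b)^2\le72\,l\,u'$, where $u'$ is the noisy distance, and $El\le1$ with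
    [h2 a b] $\le|a-b|$ gives the quadratic term. *)
Lemma score_ge_h2_half E a b : 2 <= E -> 0 <= a -> 0 <= b ->
  Num.min (h2 a b) (E * h2 a b ^+ 2) <=
    72 * h2 (rr_lo E + (rr_hi E - rr_lo E) * a) (rr_lo E + (rr_hi E - rr_lo E) * b).
Proof.
move=> E2 a0 b0; have E0 : 0 < E by lra.
have := rr_add E E0; have := rr_hiE E E0; have := rr_lo_gt0 E E0.
move: (rr_lo E) (rr_hi E) => l h l0 hE lh.
have lh' : 3^-1 <= h - l by nra.
set s := h - l in lh' *.
have s1 : s <= 1 by rewrite /s; lra.
have := h2_ge (l + s * a) (l + s * b).
have -> : l + s * a - (l + s * b) = s * (a - b) by ring.
have := h2_ge0 (l + s * a) (l + s * b).
move: (h2 (l + _) _) => u' u'0 /(_ _ _) H.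
have {}H : (s * (a - b)) ^+ 2 <= 2 * (l + s * a + (l + s * b)) * u'.
  by apply: H; nra.
have {}H : (a - b) ^+ 2 <= 18 * (2 * l + (a + b)) * u'.
  have h1 : (a - b) ^+ 2 <= 9 * (s * (a - b)) ^+ 2.
    rewrite exprMn mulrA -{1}[_ ^+ 2]mul1r; apply: ler_wpM2r; first exact: sqr_ge0.
    nra.
  apply: (le_trans h1).
  suff : (l + s * a + (l + s * b)) * u' <= (2 * l + (a + b)) * u' by lra.
  apply: ler_wpM2r => //; nra.
have H1 := h2_le a b a0 b0; have H2 := h2_le_norm a b a0 b0.
have u0 := h2_ge0 a b; move: (h2 a b) u0 H1 H2 => u u0 H1 H2.
rewrite ge_min; apply/orP.
case: (leP (2 * l) (a + b)) => hab.
  left; have ab0 : 0 < a + b by lra.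
  rewrite -(ler_pM2r ab0); apply: (le_trans H1); apply: (le_trans H).
  have := mulr_ge0 (ltW ab0) u'0.
  have : 2 * l * u' <= (a + b) * u' by apply: ler_wpM2r.
  lra.
right; have : u ^+ 2 <= (a - b) ^+ 2.
  by rewrite -(real_normK (num_real (a - b))) lerXn2r ?nnegrE.
have lu : (a + b) * u' <= 2 * l * u' by apply: ler_wpM2r => //; lra.
move=> uD; have : E * u ^+ 2 <= E * (72 * (l * u')) by apply: ler_wpM2l; lra.
have : E * (l * u') <= 1 * u' by rewrite mulrA; apply: ler_wpM2r => //; lra.
lra.
Qed.

Lemma score_ge_h2 E P Q : 2 <= E -> 0 <= P <= 1 -> 0 <= Q <= 1 ->
  Num.min (h2 P Q) (E * h2 P Q ^+ 2) <= 72 * score E P Q.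
Proof.
move=> E2 /andP[P0 _] /andP[Q0 _].
apply: (le_trans (score_ge_h2_half E P Q E2 P0 Q0)).
rewrite ler_pM2l ?ltr0n// lerDl; exact: h2_ge0.
Qed.

End Scalar.

(** * Quantization by superlevel sets of the likelihood ratio *)

(** Induction on $m$: if $2^{-(m+1)}\le x$, the new term $2\cdot2^{-(m+1)}$ pays for the old
    remainder $2^{-m}$; otherwise $x$ is below the new remainder. *)
Lemma dyadic_layers {R : realType} (m : nat) (x : R) : 0 <= x <= 1 ->
  x <= \sum_(j < m.+1) 2 * 2^-1 ^+ j * (2^-1 ^+ j <= x)%R%:R + 2^-1 ^+ m.
Proof.
move=> /andP[x0 x1].
have term_ge0 j : 0 <= 2 * 2^-1 ^+ j * (2^-1 ^+ j <= x)%R%:R :> R.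
  by rewrite mulr_ge0// mulr_ge0// exprn_ge0// invr_ge0.
elim: m => [|m IH].
  by rewrite expr0 (le_trans x1)// lerDr sumr_ge0.
rewrite big_ord_recr /=.
have [h|h] := leP (2^-1 ^+ m.+1) x; move: h; rewrite exprS => h; last first.
  rewrite mulr0 addr0 (le_trans (ltW h))// lerDr sumr_ge0//.
apply: (le_trans IH); rewrite mulr1 -addrA lerD2l.
have : 0 <= 2^-1 ^+ m :> R by rewrite exprn_ge0// invr_ge0.
move: (2^-1 ^+ m) => y; lra.
Qed.

Section Quantizer.
Context {R : realType} {k : nat}.
Implicit Types (p q : 'I_k -> R) (S : pred 'I_k) (c B : R).

Definition mass p S : R := \sum_(i | S i) p i.

(* This is the likelihood ratio, rescaled to [[-1, 1]] and antisymmetric in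
   [p] and [q]; it is [0] (by [x / 0 = 0]) off the supports of [p] and [q]. *)
Definition tilt p q (i : 'I_k) : R := (p i - q i) / (p i + q i).

Definition superlevel p q c : pred 'I_k := fun i => c <= tilt p q i.

Lemma tiltC p q i : tilt q p i = - tilt p q i.
Proof. by rewrite /tilt -mulNr opprB (addrC (p i)). Qed.

Lemma tilt_le1 p q i : 0 <= p i -> 0 <= q i -> tilt p q i <= 1.
Proof.
move=> p0 q0; rewrite /tilt.
have [s0|s0] := eqVneq (p i + q i) 0; first by rewrite s0 invr0 mulr0.
rewrite ler_pdivrMr ?mul1r; last by rewrite lt_neqAle eq_sym s0 addr_ge0.
lra.
Qed.

Lemma tiltM p q i : 0 <= p i -> 0 <= q i ->
  tilt p q i * (p i + q i) = p i - q i.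
Proof.
move=> p0 q0; rewrite /tilt.
have [s0|s0] := eqVneq (p i + q i) 0; last by rewrite divfK.
rewrite s0 mulr0; lra.
Qed.

Lemma tilt_gt0 p q i : 0 <= p i -> 0 <= q i -> (0 < tilt p q i) = (q i < p i).
Proof.
move=> p0 q0; rewrite /tilt.
have [s0|s0] := eqVneq (p i + q i) 0.
  rewrite s0 invr0 mulr0 ltxx; apply/esym/negbTE; rewrite -leNgt; lra.
by rewrite pmulr_lgt0 ?subr_gt0// invr_gt0 lt_neqAle eq_sym s0 addr_ge0.
Qed.

Lemma mass_ge0 p S : (forall i, 0 <= p i) -> 0 <= mass p S.
Proof. by move=> p0; apply: sumr_ge0. Qed.

Lemma massC p S : \sum_i p i = 1 -> mass p (predC S) = 1 - mass p S.
Proof. by move=> p1; rewrite -p1 (bigID S)/= addrC addrK. Qed.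

Lemma mass_le1 p S : is_dist p -> 0 <= mass p S <= 1.
Proof.
move=> [p0 p1]; rewrite mass_ge0//= -subr_ge0 -massC//; exact: mass_ge0.
Qed.

(** Let $P$, $Q$ be the masses of the superlevel set. Summing [tiltM] over it gives $c(P+Q)\le P-Q$;
    multiply [h2_ge], that is $(P-Q)^2\le2(P+Q)\,h_2(P,Q)$, by $c$ and divide by $P-Q$. *)
Lemma superlevel_gap p q c : (forall i, 0 <= p i) -> (forall i, 0 <= q i) ->
  0 < c ->
  c * (mass p (superlevel p q c) - mass q (superlevel p q c)) <=
    2 * h2 (mass p (superlevel p q c)) (mass q (superlevel p q c)).
Proof.
move=> p0 q0 c0; set S := superlevel p q c.
have gap : c * (mass p S + mass q S) <= mass p S - mass q S.
  rewrite /mass -sumrN -!big_split/= mulr_sumr; apply: ler_sum => i Si.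
  by rewrite -tiltM// ler_wpM2r// addr_ge0.
have P0 := mass_ge0 p S p0; have Q0 := mass_ge0 q S q0.
have H := h2_ge _ _ P0 Q0; have H0 := h2_ge0 (mass p S) (mass q S).
move: (mass p S) (mass q S) gap P0 Q0 H H0 => P Q gap P0 Q0.
move: (h2 _ _) => u H u0.
have D0 : 0 <= P - Q by apply: le_trans gap; rewrite mulr_ge0 ?addr_ge0// ltW.
have [D|D] := eqVneq (P - Q) 0; first by rewrite D mulr0 mulr_ge0.
have {D}D0 : 0 < P - Q by rewrite lt_neqAle eq_sym D.
rewrite -(ler_pM2r D0).
have : c * (P - Q) ^+ 2 <= 2 * u * (c * (P + Q)).
  rewrite (_ : 2 * u * _ = c * (2 * (P + Q) * u)); last ring.
  by rewrite ler_pM2l.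
have : 2 * u * (c * (P + Q)) <= 2 * u * (P - Q) by rewrite ler_wpM2l// mulr_ge0.
lra.
Qed.

Lemma half_hellinger_le p q m B : is_dist p -> is_dist q ->
  (forall c, 0 < c ->
     h2 (mass p (superlevel p q c)) (mass q (superlevel p q c))
       <= B) ->
  \sum_(i | q i < p i) h2 (p i) (q i) <= 4 * m.+1%:R * B + 2^-1 ^+ m.
Proof.
move=> [p0 p1] [q0 q1] HB.
have bound i : q i < p i -> h2 (p i) (q i) <=
    \sum_(j < m.+1) 2 * (2^-1 ^+ j * ((p i - q i) * (2^-1 ^+ j <= tilt p q i)%R%:R))
    + 2^-1 ^+ m * (p i - q i).
  move=> lt_qp; have s0 : 0 < p i + q i by apply: ltr_wpDr => //; exact: le_lt_trans lt_qp.
  have t01 : 0 <= tilt p q i <= 1 by rewrite tilt_le1// ltW// tilt_gt0.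
  apply: (@le_trans _ _ ((p i - q i) * tilt p q i)).
    rewrite -(ler_pM2r s0) (le_trans (h2_le _ _ (p0 i) (q0 i)))//.
    by rewrite -mulrA tiltM.
  have := @dyadic_layers R m _ t01.
  move/(ler_wpM2l (x := p i - q i)); rewrite subr_ge0 => /(_ (ltW lt_qp)) h.
  apply: (le_trans h); rewrite mulrDr (mulrC _ (2^-1 ^+ m)) lerD2r mulr_sumr.
  by apply: ler_sum => j _; rewrite le_eqVlt; apply/orP; left; apply/eqP; ring.
apply: le_trans (ler_sum _ bound) _.
rewrite big_split/= exchange_big/= -mulr_sumr.
apply: lerD; last first.
  rewrite -[leRHS]mulr1; apply: ler_wpM2l; first by rewrite exprn_ge0// invr_ge0.
  rewrite (@le_trans _ _ (\sum_(i | q i < p i) p i))//.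
    by apply: ler_sum => i _; rewrite gerBl.
  by have /andP[] := @mass_le1 p (fun i => q i < p i) (conj p0 p1).
have -> : 4 * m.+1%:R * B = \sum_(j < m.+1) 4 * B.
  by rewrite sumr_const card_ord -mulr_natl; ring.
apply: ler_sum => j _; have c0 : 0 < 2^-1 ^+ j :> R by rewrite exprn_gt0// invr_gt0.
move: (2^-1 ^+ j) c0 => c c0.
(* Since $c>0$, the superlevel set lies inside $\{q<p\}$, so the indicator sum is the whole mass
   gap. *)
rewrite -!mulr_sumr (_ : \sum_(i | _) _ =
  mass p (superlevel p q c) - mass q (superlevel p q c)).
  have := @superlevel_gap p q c p0 q0 c0; have := HB c c0; move=> /= *; lra.
rewrite /mass /superlevel -sumrB big_mkcond [RHS]big_mkcond/=; apply: eq_bigr => i _.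
have [ct|ct] := leP c (tilt p q i); last by rewrite mulr0 if_same.
by rewrite -tilt_gt0// (lt_le_trans c0 ct) mulr1.
Qed.

Lemma dH2_split p q : dH2 p q =
  \sum_(i | q i < p i) h2 (p i) (q i) + \sum_(i | p i < q i) h2 (q i) (p i).
Proof.
rewrite /dH2 (bigID (fun i => q i < p i))/=; congr (_ + _).
rewrite big_mkcond [RHS]big_mkcond/=; apply: eq_bigr => i _.
rewrite -leNgt; case: ltgtP => // [_|->]; first by rewrite h2C.
by rewrite subrr expr0n.
Qed.

(** The superlevel set at 0 is $\{q\le p\}$, and since both laws have mass 1 the deficit off it
    equals the excess on it. *)
Lemma dTV_split p q : is_dist p -> is_dist q ->
  dTV p q = mass p (superlevel p q 0) - mass q (superlevel p q 0).
Proof.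
move=> dp dq; have [p0 p1] := dp; have [q0 q1] := dq.
rewrite /dTV (bigID (superlevel p q 0))/=.
rewrite (eq_bigr (fun i => p i - q i)); last first.
  move=> i; rewrite /superlevel leNgt -oppr_gt0 -tiltC tilt_gt0// -leNgt => h.
  by rewrite ger0_norm// subr_ge0.
rewrite [X in _ + X](eq_bigr (fun i => q i - p i)); last first.
  move=> i; rewrite /superlevel -ltNge -oppr_gt0 -tiltC tilt_gt0// => h.
  by rewrite ltr0_norm ?opprB// subr_lt0.
rewrite !sumrB.
have Pc : \sum_(i | ~~ superlevel p q 0 i) p i = _ := massC p _ p1.
have Qc : \sum_(i | ~~ superlevel p q 0 i) q i = _ := massC q _ q1.
rewrite Pc Qc -/(mass p _) -/(mass q _); lra.
Qed.

End Quantizer.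

(** * Lower bounds on the score of the best threshold *)

Section BestThreshold.
Context {R : realType} {k : nat}.
Implicit Types (p q : 'I_k -> R) (E M : R).

Definition threshold_score p q E c : R :=
  score E (mass p (superlevel p q c)) (mass q (superlevel p q c)).

(** A nonempty set that is upward closed for [tilt] is the superlevel set at its least tilt, so the
    $k$ attained thresholds cover every real threshold, strict or not. The empty set has score 0. *)
Lemma upward_score_le p q E M (S : pred 'I_k) : 0 <= M ->
  (forall j, threshold_score p q E (tilt p q j) <= M) ->
  (forall i i', S i -> tilt p q i <= tilt p q i' -> S i') ->
  score E (mass p S) (mass q S) <= M.
Proof.
move=> M0 HM up; case: (pickP S) => [i0 Si0|S0]; last first.
  by rewrite /mass !big_pred0// scorexx.
case: (@arg_minP _ _ _ i0 S (tilt p q) Si0) => j Sj jmin.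
apply: le_trans (HM j); rewrite le_eqVlt; apply/orP; left; apply/eqP.
have SE : S =1 superlevel p q (tilt p q j).
  by move=> i; apply/idP/idP => [/jmin//|]; exact: up.
by rewrite /threshold_score /mass !(eq_bigl _ _ SE).
Qed.

Lemma best_threshold_tv p q E M : is_dist p -> is_dist q -> 1 <= E -> 0 <= M ->
  (forall j, threshold_score p q E (tilt p q j) <= M) ->
  ((rr_hi E - rr_lo E) * dTV p q) ^+ 2 <= 4 * M.
Proof.
move=> dp dq E1 M0 HM; rewrite dTV_split//.
apply: le_trans (score_ge_tv _ _ _ E1 (mass_le1 p _ dp) (mass_le1 q _ dq)) _.
rewrite ler_pM2l// upward_score_le// => i i'; exact: le_trans.
Qed.

(** It is enough that $e^{1/2}\le2$, which follows from $e^{-1/2}\ge1-1/2$. *)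
Lemma pow2_ge_expR (m : nat) : expR (m%:R / 2) <= 2 ^+ m :> R.
Proof.
rewrite expRM_natl lerXn2r ?nnegrE ?expR_ge0//.
rewrite -(invrK 2) -[X in expR X]opprK expRN lef_pV2 ?posrE ?expR_gt0 ?invr_gt0//.
apply: le_trans (expR_ge1Dx _); lra.
Qed.

Lemma lnp_ge1 (x : R) : 1 <= lnp x.
Proof. by rewrite le_max lexx. Qed.

Lemma ln_le_lnp (x : R) : ln x <= lnp x.
Proof. by rewrite le_max lexx orbT. Qed.

Lemma exists_pow2_gt (h : R) : 0 < h ->
  exists m : nat, 4 / h < 2 ^+ m /\ m.+1%:R <= 10 * lnp (1 / h).
Proof.
move=> h0; have L1 := lnp_ge1 (1 / h).
have L2 := ln_le_lnp (1 / h).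
(* With $L$ = [lnp (1 / h)] and $m=t+1$: $2^m\ge e^{m/2}\ge e^{L+3}$ and $e^3>4$, while
   $m+1\le2L+8\le10L$ because $L\ge1$. *)
have [t [lo hi]] : exists t : nat, t%:R <= 2 * lnp (1 / h) + 6 /\
    2 * lnp (1 / h) + 6 < t.+1%:R.
  exists (Num.truncn (2 * lnp (1 / h) + 6)); apply/andP/truncn_itv; lra.
exists t.+1; split; last by rewrite -addn2 natrD; lra.
apply: lt_le_trans (pow2_ge_expR _).
have -> : 4 / h = 4 * expR (ln (1 / h)) by rewrite lnK ?posrE ?divr_gt0// mul1r.
apply: (@lt_le_trans _ _ (expR 3 * expR (ln (1 / h)))).
  rewrite ltr_pM2r ?expR_gt0//; apply: le_lt_trans (expR_gt1Dx _); last by [].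
  lra.
rewrite -expRD ler_expR; lra.
Qed.

(* [160] is [16 * 10]: layering over [m + 1] dyadic levels on each side loses a
   factor [16 (m + 1)], and [m + 1 <= 10 * lnp (1 / dH2)]. *)
Definition log_factor p q : R := 160 * lnp (1 / dH2 p q).

Lemma log_factor_gt0 p q : 0 < log_factor p q.
Proof. rewrite /log_factor; have := lnp_ge1 (1 / dH2 p q); lra. Qed.

(** The contrapositive of the monotonicity of $x\mapsto\min(x,Ex^2)$ on nonnegative reals. *)
Lemma min_sqr_lt (E x y : R) : 0 < E -> 0 <= x ->
  Num.min x (E * x ^+ 2) < Num.min y (E * y ^+ 2) -> x <= y.
Proof.
move=> E0 x0; case: (leP x y) => // lt_yx; apply: contraTT => _; rewrite -leNgt.
rewrite le_min !ge_min (ltW lt_yx) /=; case: (leP 0 y) => y0.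
  by rewrite ler_pM2l// lerXn2r ?nnegrE ?(ltW lt_yx)// orbT.
by rewrite (le_trans (ltW y0))// mulr_ge0 ?sqr_ge0// ltW.
Qed.

(** By contradiction: if $M$ were smaller, every superlevel set would have Hellinger contribution at
    most $B$ = [dH2 p q / log_factor p q]. Then [dH2 p q] $\le8(m+1)B+2\cdot2^{-m}$, and for the $m$
    of [exists_pow2_gt] the first term is at most, and the second strictly below, half of
    [dH2 p q]. *)
Lemma best_threshold_hellinger p q E M : is_dist p -> is_dist q -> 2 <= E ->
  0 <= M -> 0 < dH2 p q ->
  (forall j, threshold_score p q E (tilt p q j) <= M) ->
  Num.min (dH2 p q / log_factor p q) (E * (dH2 p q / log_factor p q) ^+ 2)
    <= 72 * M.
Proof.
move=> dp dq E2 M0 h0 HM; rewrite leNgt; apply/negP => lt_M.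
have E0 : 0 < E by lra.
have below (S : pred 'I_k) : score E (mass p S) (mass q S) <= M ->
    h2 (mass p S) (mass q S) <= dH2 p q / log_factor p q.
  move=> SM; apply: (min_sqr_lt E) => //; first exact: h2_ge0.
  apply: le_lt_trans lt_M.
  apply: le_trans (score_ge_h2 _ _ _ E2 (mass_le1 p S dp) (mass_le1 q S dq)) _.
  by rewrite ler_pM2l.
have [m [lt_m le_m]] := exists_pow2_gt _ h0.
have Hp : \sum_(i | q i < p i) h2 (p i) (q i) <=
    4 * m.+1%:R * (dH2 p q / log_factor p q) + 2^-1 ^+ m.
  apply: half_hellinger_le => // c c0; apply/below/upward_score_le => // i i'.
  exact: le_trans.
have Hq : \sum_(i | p i < q i) h2 (q i) (p i) <=
    4 * m.+1%:R * (dH2 p q / log_factor p q) + 2^-1 ^+ m.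
  apply: half_hellinger_le => // c c0; rewrite h2C; apply: below.
  have [_ p1] := dp; have [_ q1] := dq.
  (* A superlevel set of [tilt q p] is a lower set for [tilt p q]; its complement is upward closed
     and has the same score. *)
  rewrite -score_compl -!massC//; apply: upward_score_le => // i i' /=.
  rewrite /superlevel (tiltC p q i) (tiltC p q i') -!ltNge !(ltrNl _ c).
  exact: lt_le_trans.
have : dH2 p q <= 8 * (m.+1%:R * (dH2 p q / log_factor p q)) + 2 * 2^-1 ^+ m.
  rewrite {1}dH2_split; lra.
have : m.+1%:R * (dH2 p q / log_factor p q) <= dH2 p q / 16.
  have L0 := lnp_ge1 (1 / dH2 p q).
  rewrite mulrA ler_pdivrMr ?log_factor_gt0// /log_factor.
  have := ler_wpM2r (ltW h0) le_m; lra.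
have : 2^-1 ^+ m < dH2 p q / 4.
  rewrite exprVn -[ltRHS]invrK ltf_pV2 ?posrE ?exprn_gt0 ?invr_gt0 ?divr_gt0//.
  by rewrite invf_div.
lra.
Qed.

End BestThreshold.

(** * The search for the best threshold *)

Section Runs.
Context {R : realType}.
Implicit Types (s : @store R) (Post : @store R -> Prop).

(** A total-correctness Hoare judgment with a time budget; as $t$ is only an upper bound, branches
    of different cost can share one budget. *)
Definition runs (c : cmd) s (t : nat) Post : Prop :=
  exists t' s', [/\ exec c s t' s', (t' <= t)%N & Post s'].

Lemma beval_le s e1 e2 : beval s (RLe e1 e2) = (reval s e1 <= reval s e2).
Proof. by []. Qed.

Lemma runs_skip s t Post : (0 < t)%N -> Post s -> runs Skip s t Post.
Proof. by move=> t0 H; exists 1%N, s; split=> //; constructor. Qed.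

Lemma runs_nset v e s t Post : (0 < t)%N ->
  Post (set_nvar s v (neval s e)) -> runs (NSet v e) s t Post.
Proof. by move=> t0 H; exists 1%N, (set_nvar s v (neval s e)); split=> //; constructor. Qed.

Lemma runs_rset a i e s t Post : (0 < t)%N ->
  Post (set_rarr s a (neval s i) (reval s e)) -> runs (RSet a i e) s t Post.
Proof.
move=> t0 H; exists 1%N, (set_rarr s a (neval s i) (reval s e)); split=> //.
by constructor.
Qed.

Lemma runs_seq c1 c2 s t1 t2 t Post : (t1 + t2 <= t)%N ->
  runs c1 s t1 (fun s1 => runs c2 s1 t2 Post) -> runs (Seq c1 c2) s t Post.
Proof.
move=> tt [u1 [s1 [e1 l1 [u2 [s2 [e2 l2 H]]]]]].
exists (u1 + u2)%N, s2; split=> //; first exact: exec_seq e1 e2.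
by rewrite (leq_trans _ tt)// leq_add.
Qed.

Lemma runs_if b c1 c2 s t Post :
  runs (if beval s b then c1 else c2) s t Post -> runs (If b c1 c2) s t.+1 Post.
Proof.
move=> [u [s' [e l H]]]; exists u.+1, s'; split=> //; exact: exec_if.
Qed.

Lemma runs_weaken c s t t' Post Post' : (t <= t')%N ->
  (forall s', Post s' -> Post' s') -> runs c s t Post -> runs c s t' Post'.
Proof.
move=> tt sub [u [s' [e l H]]]; exists u, s'; split=> //; first exact: leq_trans tt.
exact: sub.
Qed.

(** Each round pays [tb] for the body and 1 for the guard; the last 1 is the failing guard. *)
Lemma runs_for (v k tb : nat) (body : cmd) (I : nat -> @store R -> Prop) s :
  (forall j s, I j s -> nvar s v = j /\ nvar s 0 = k) ->
  (forall j s, (j < k)%N -> I j s -> runs body s tb (I j.+1)) ->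
  I 0%N s -> runs (While (NLt (NVar v) (NVar 0)) body) s (k * tb.+1).+1 (I k).
Proof.
move=> Iv Ib I0.
suff gen m j s0 : (j + m = k)%N -> I j s0 ->
    runs (While (NLt (NVar v) (NVar 0)) body) s0 (m * tb.+1).+1 (I k).
  exact: gen I0.
elim: m j s0 => [|m IH] j s0 jm Is; have [vj vk] := Iv _ _ Is.
  move: jm; rewrite addn0 => jk; exists 1%N, s0; split=> //; last by rewrite -jk.
  by apply: exec_while_false; rewrite /= vj vk jk ltnn.
have lt_jk : (j < k)%N by lia.
have [u [s1 [e1 l1 I1]]] := Ib _ _ lt_jk Is.
have [|u2 [s2 [e2 l2 I2]]] := IH j.+1 s1 _ I1; first lia.
exists (u + u2).+1, s2; split=> //; last by lia.
by apply: exec_while_true e1 e2; rewrite /= vj vk.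
Qed.

End Runs.

(** * The program *)

Definition tilt_exp (i : nexp) : rexp :=
  RDiv (RSub (RGet 0 i) (RGet 1 i)) (RAdd (RGet 0 i) (RGet 1 i)).

Definition E_exp : rexp := RExp (RGet 2 (NConst 0)).
Definition lo_exp : rexp := RDiv (RConst 1) (RAdd (RConst 1) E_exp).
Definition hi_exp : rexp := RDiv E_exp (RAdd (RConst 1) E_exp).

Definition h2_exp (a b : rexp) : rexp :=
  RMul (RSub (RSqrt a) (RSqrt b)) (RSub (RSqrt a) (RSqrt b)).

Definition score_exp (P Q : rexp) : rexp :=
  RAdd
    (h2_exp (RAdd lo_exp (RMul (RSub hi_exp lo_exp) P))
            (RAdd lo_exp (RMul (RSub hi_exp lo_exp) Q)))
    (h2_exp (RSub hi_exp (RMul (RSub hi_exp lo_exp) P))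
            (RSub hi_exp (RMul (RSub hi_exp lo_exp) Q))).

Definition scratch (i : nat) : rexp := RGet 5 (NConst i).

(** Natural variable 1 is the index whose tilt is the candidate threshold; variable 2 runs over the
    letters. *)
Definition mass_body : cmd :=
  Seq (If (RLe (tilt_exp (NVar 1)) (tilt_exp (NVar 2)))
          (Seq (RSet 5 (NConst 0) (RAdd (scratch 0) (RGet 0 (NVar 2))))
               (RSet 5 (NConst 1) (RAdd (scratch 1) (RGet 1 (NVar 2)))))
          Skip)
      (NSet 2 (NSucc (NVar 2))).

Definition search_body : cmd :=
  Seq (RSet 5 (NConst 0) (RConst 0))
  (Seq (RSet 5 (NConst 1) (RConst 0))
  (Seq (NSet 2 (NConst 0))
  (Seq (While (NLt (NVar 2) (NVar 0)) mass_body)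
  (Seq (If (RLe (score_exp (scratch 0) (scratch 1)) (scratch 2))
           Skip
           (Seq (RSet 5 (NConst 2) (score_exp (scratch 0) (scratch 1)))
                (RSet 5 (NConst 3) (tilt_exp (NVar 1)))))
       (NSet 1 (NSucc (NVar 1))))))).

Definition output_body : cmd :=
  Seq (If (RLe (scratch 3) (tilt_exp (NVar 2)))
          (Seq (RSet 3 (NVar 2) hi_exp) (RSet 4 (NVar 2) lo_exp))
          (Seq (RSet 3 (NVar 2) lo_exp) (RSet 4 (NVar 2) hi_exp)))
      (NSet 2 (NSucc (NVar 2))).

(* Array 5 is scratch space: cells 0 and 1 accumulate the masses of the current
   superlevel set under [p] and [q]; cells 2 and 3 hold the best score so far
   and its threshold, which start at 0. *)
Definition best_threshold_prog : cmd :=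
  Seq (While (NLt (NVar 1) (NVar 0)) search_body)
  (Seq (NSet 2 (NConst 0))
       (While (NLt (NVar 2) (NVar 0)) output_body)).

(** * Correctness and running time of the program *)

Section Correctness.
Context {R : realType} {k : nat}.
Variables (p q : 'I_k -> R) (eps : R).

Definition holds_input (s : @store R) : Prop :=
  [/\ nvar s 0 = k, rarr s 0 = array_of p, rarr s 1 = array_of q &
      rarr s 2 0%N = eps].

Definition ntilt (l : nat) : R :=
  (array_of p l - array_of q l) / (array_of p l + array_of q l).

Lemma array_ofE (f : 'I_k -> R) (i : 'I_k) : array_of f i = f i.
Proof. by rewrite /array_of valK. Qed.

Lemma ntiltE (i : 'I_k) : ntilt i = tilt p q i.
Proof. by rewrite /ntilt !array_ofE. Qed.

Definition partial_mass (f : 'I_k -> R) (c : R) (i : nat) : R :=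
  \sum_(0 <= l < i | c <= ntilt l) array_of f l.

Lemma partial_massE (f : 'I_k -> R) c :
  partial_mass f c k = mass f (superlevel p q c).
Proof.
rewrite /partial_mass big_mkord /mass; apply: eq_big => i.
  by rewrite ntiltE.
by rewrite array_ofE.
Qed.

Lemma partial_massS f c i : partial_mass f c i.+1 =
  partial_mass f c i + (if c <= ntilt i then array_of f i else 0).
Proof. by rewrite /partial_mass big_mkcond big_nat_recr//= -big_mkcond. Qed.

Lemma reval_tilt s v : holds_input s ->
  reval s (tilt_exp (NVar v)) = ntilt (nvar s v).
Proof. by move=> [_ /= -> -> _]. Qed.

Lemma reval_lo s : holds_input s -> reval s lo_exp = rr_lo (expR eps).
Proof. by move=> [_ _ _ /= ->]. Qed.

Lemma reval_hi s : holds_input s -> reval s hi_exp = rr_hi (expR eps).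
Proof. by move=> [_ _ _ /= ->]. Qed.

Lemma reval_score s P Q : holds_input s ->
  reval s (score_exp P Q) = score (expR eps) (reval s P) (reval s Q).
Proof. by move=> [_ _ _ /= ->]. Qed.

(** The parameters $b$ and $c$ record that the inner loop leaves the best score and its threshold
    untouched. *)
Definition mass_inv (j : nat) (b c : R) (i : nat) (s : @store R) : Prop :=
  holds_input s /\
  [/\ nvar s 1 = j, nvar s 2 = i,
      rarr s 5 0%N = partial_mass p (ntilt j) i /\
      rarr s 5 1%N = partial_mass q (ntilt j) i,
      rarr s 5 2%N = b & rarr s 5 3%N = c].

Lemma mass_body_runs j b c i s : mass_inv j b c i s ->
  runs mass_body s 4 (mass_inv j b c i.+1).
Proof.
move=> [inp [v1 v2 [m0 m1] m2 m3]]; have [i0 i1 i2 i3] := inp.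
apply: (@runs_seq _ _ _ _ 3 1) => //; apply: runs_if.
rewrite beval_le !reval_tilt// v1 v2.
case: ifPn => h.
  apply: (@runs_seq _ _ _ _ 1 1) => //; apply: runs_rset => //.
  apply: runs_rset => //; apply: runs_nset => //=.
  split=> //; split=> //=; rewrite ?v2//.
  by rewrite !partial_massS h m0 m1 i1 i2.
apply: runs_skip => //; apply: runs_nset => //=.
split=> //; split=> //=; rewrite ?v2//.
by rewrite !partial_massS (negbTE h) !addr0.
Qed.

(** The stored score is only required to be at most that of the stored threshold: this holds for the
    initial pair of zeros because scores are nonnegative. *)
Definition search_inv (j : nat) (s : @store R) : Prop :=
  holds_input s /\
  [/\ nvar s 1 = j,
      rarr s 5 2%N <= threshold_score p q (expR eps) (rarr s 5 3%N) &
      forall l : 'I_k, (l < j)%N ->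
        threshold_score p q (expR eps) (tilt p q l) <= rarr s 5 2%N].

Lemma search_body_runs j s : (j < k)%N -> search_inv j s ->
  runs search_body s (k * 5 + 8) (search_inv j.+1).
Proof.
move=> jk [inp [v1 best maxi]]; have [i0 i1 i2 i3] := inp.
(* Budget: three assignments, $5k+1$ for the inner loop, 3 for the conditional, 1 for the
   counter. *)
apply: (@runs_seq _ _ _ _ 1 (k * 5 + 7)); first lia.
apply: runs_rset => //.
apply: (@runs_seq _ _ _ _ 1 (k * 5 + 6)); first lia.
apply: runs_rset => //.
apply: (@runs_seq _ _ _ _ 1 (k * 5 + 5)); first lia.
apply: runs_nset => //.
apply: (@runs_seq _ _ _ _ (k * 5).+1 4); first lia.
set b := rarr s 5 2%N in best maxi *; set c := rarr s 5 3%N in best *.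
have := @runs_for R 2 k 4 mass_body (mass_inv j b c).
move/(_ (set_nvar (set_rarr (set_rarr s 5 0 0) 5 1 0) 2 0)) => H.
apply: (runs_weaken _ _ _ _ _ _ (leqnn _) _ (H _ _ _)); last first.
- split=> //; split=> //=; by rewrite /partial_mass !big_geq.
- move=> i s' _; exact: mass_body_runs.
- by move=> i s' [[? _ _ _] [_ ? _ _ _]].
move=> {H} s' [inp' [v1' _ [m0 m1] m2 m3]].
rewrite !partial_massE in m0 m1.
have jT : ntilt j = tilt p q (Ordinal jk) by rewrite -ntiltE.
have sc : reval s' (score_exp (scratch 0) (scratch 1)) =
    threshold_score p q (expR eps) (tilt p q (Ordinal jk)).
  by rewrite reval_score//= m0 m1 jT.
apply: (@runs_seq _ _ _ _ 3 1) => //; apply: runs_if.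
rewrite beval_le sc /= m2.
have lt_succ (l : 'I_k) : (l < j.+1)%N -> l = Ordinal jk \/ (l < j)%N.
  rewrite ltnS leq_eqVlt => /orP[/eqP e|]; last by right.
  by left; apply: val_inj.
case: leP => h.
  apply: runs_skip => //; apply: runs_nset => //=.
  split=> //; split=> /=; rewrite ?v1' ?m2 ?m3//.
  by move=> l /lt_succ[->//|]; exact: maxi.
apply: (@runs_seq _ _ _ _ 1 1) => //; apply: runs_rset => //.
apply: runs_rset => //; apply: runs_nset => //.
rewrite sc reval_tilt// [nvar _ 1]/= v1' jT.
split=> //; split=> //=; first by rewrite v1'.
by move=> l /lt_succ[->//|/maxi/le_trans]; apply; exact: ltW.
Qed.

Definition rr_channel (S : pred 'I_k) (x : 'I_k) (y : 'I_2) : R :=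
  if (y == 0%N :> nat) == S x then rr_hi (expR eps) else rr_lo (expR eps).

Definition output_inv (c : R) (i : nat) (s : @store R) : Prop :=
  holds_input s /\
  [/\ nvar s 2 = i, rarr s 5 3%N = c &
      forall (x : 'I_k) (y : 'I_2), (x < i)%N ->
        rarr s (3 + y) x = rr_channel (superlevel p q c) x y].

Lemma output_body_runs c i s : (i < k)%N -> output_inv c i s ->
  runs output_body s 4 (output_inv c i.+1).
Proof.
move=> ik [inp [v2 m3 out]]; have [i0 i1 i2 i3] := inp.
apply: (@runs_seq _ _ _ _ 3 1) => //; apply: runs_if.
rewrite beval_le reval_tilt// v2 /= m3.
rewrite -[i]/(val (Ordinal ik)) ntiltE -/(superlevel p q c _).
set x0 := Ordinal ik.
case: ifPn => h; apply: (@runs_seq _ _ _ _ 1 1) => //; apply: runs_rset => //;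
  apply: runs_rset => //; apply: runs_nset => //.
  rewrite reval_hi// reval_lo//; split=> //; split=> //=; rewrite ?v2//.
  move=> x y lt_x; rewrite -[i]/(val x0) !val_eqE.
  have [->|nx] := eqVneq x x0; last first.
    rewrite !andbF out//; move: lt_x; rewrite ltnS leq_eqVlt => /orP[/eqP e|//].
    by case/eqP: nx; exact: val_inj.
  rewrite !andbT /rr_channel h.
  by case: y => -[|[|//]].
rewrite reval_hi// reval_lo//; split=> //; split=> //=; rewrite ?v2//.
move=> x y lt_x; rewrite -[i]/(val x0) !val_eqE.
have [->|nx] := eqVneq x x0; last first.
  rewrite !andbF out//; move: lt_x; rewrite ltnS leq_eqVlt => /orP[/eqP e|//].
  by case/eqP: nx; exact: val_inj.
rewrite !andbT /rr_channel (negbTE h).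
by case: y => -[|[|//]].
Qed.

Lemma best_threshold_prog_correct : (0 < k)%N -> exists c : R,
  (forall j, threshold_score p q (expR eps) (tilt p q j) <=
             threshold_score p q (expR eps) c) /\
  finds_channel best_threshold_prog p q eps (rr_channel (superlevel p q c))
    (22 * k ^ 22)%N.
Proof.
move=> k0.
suff [t [s [e le_t [c [cbest out]]]]] : runs best_threshold_prog (input p q eps)
    ((k * (k * 5 + 9)).+1 + (1 + (k * 5).+1)) (fun s => exists c : R,
      (forall j, threshold_score p q (expR eps) (tilt p q j) <=
                 threshold_score p q (expR eps) c) /\
      forall (x : 'I_k) (y : 'I_2),
        rarr s (3 + y) x = rr_channel (superlevel p q c) x y).
  exists c; split=> //; exists t, s; split=> //; apply: leq_trans le_t _.
  (* The time is $5k^2+14k+3\le22k^2$; the exponent is raised to 22 because the theorem has one [d]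
     for both factor and exponent. *)
  have : (k ^ 2 <= k ^ 22)%N by rewrite leq_pexp2l.
  move: (k ^ 22)%N => K; nia.
apply: (@runs_seq _ _ _ _ _ _ _ _ (leqnn _)).
have inp : holds_input (input p q eps) by [].
have := @runs_for R 1 k (k * 5 + 8) search_body search_inv (input p q eps).
rewrite -addnS => H; apply: (runs_weaken _ _ _ _ _ _ (leqnn _) _ (H _ _ _)).
- move=> {H} s [inp' [v1 best maxi]].
  apply: (@runs_seq _ _ _ _ _ _ _ _ (leqnn _)); apply: runs_nset => //.
  apply: (runs_weaken _ _ _ _ _ _ (leqnn _) _
    (@runs_for R 2 k 4 output_body (output_inv (rarr s 5 3%N)) _ _ _ _)).
  + move=> s' [_ [_ _ out]]; exists (rarr s 5 3%N); split.
      by move=> j; exact: le_trans (maxi j (ltn_ord j)) best.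
    by move=> x y; exact: out.
  + by move=> i s' [[? _ _ _] [? _ _]].
  + by move=> i s'; exact: output_body_runs.
  + by split=> //; split.
- by move=> i s' [[? _ _ _] [? _ _]].
- exact: search_body_runs.
- by split=> //; split=> //=; exact: score_ge0.
Qed.

End Correctness.

(** * Affinity of product laws *)

Section EsumFinite.
Context {R : realType}.

Lemma esum_finType (T : finType) (A : pred T) (f : T -> R) :
  (forall i, 0 <= f i) ->
  \esum_(i in [set i | A i]) (f i)%:E = (\sum_(i | A i) f i)%:E.
Proof.
move=> f0; rewrite esum_fset; last by move=> i _; rewrite lee_fin.
  rewrite (fsbigE (enum A)) ?enum_uniq//=.
  - rewrite sumEFin big_enum_cond; congr (_%:E); apply: eq_bigl => i.
    by rewrite mem_setE unfold_in andbb.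
  - by move=> i /=; rewrite mem_enum.
  - by move=> i /= Ai; rewrite mem_enum unfold_in Ai.
exact: finite_finset.
Qed.

Lemma esum_pull (T U : choiceType) (e : T -> U) (A : set U) (f : U -> \bar R) :
  injective e -> (forall y, ~ range e y -> f y = 0%E) ->
  \esum_(y in A) f y = \esum_(x in e @^-1` A) f (e x).
Proof.
move=> inj f0; rewrite -(@esum_image _ _ _ (e @^-1` A) e f); last by move=> x y _ _; exact: inj.
rewrite esum_mkcond [RHS]esum_mkcond; apply: eq_esum => y _.
case: (boolP (y \in A)); case: (boolP (y \in e @` _)) => //.
- rewrite notin_setE inE => ny yA; apply: f0 => -[x _ xy].
  by apply: ny; exists x => //; rewrite /preimage/= xy.
- by rewrite inE notin_setE => -[x xA <-].
Qed.

Lemma esum_image_le (T : finType) (U : choiceType) (e : T -> U) (A : pred U)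
    (f : U -> R) : injective e -> (forall y, 0 <= f y) ->
  ((\sum_(x | A (e x)) f (e x))%:E <= \esum_(y in [set y | A y]) (f y)%:E)%E.
Proof.
move=> inj f0; rewrite -(@esum_finType _ (A \o e) (f \o e)); last by move=> x; exact: f0.
rewrite -(@esum_image _ _ _ _ e (fun y => (f y)%:E)); last first.
  by move=> x y _ _; exact: inj.
rewrite esum_mkcond [leRHS]esum_mkcond; apply: le_esum => y _.
case: ifPn => [|_]; last by case: ifP => // _; rewrite lee_fin.
by rewrite inE => -[x Ax <-]; rewrite ifT// inE.
Qed.

End EsumFinite.

Section Product.
Context {R : realType}.

Lemma sum_prod_ffun (I J : finType) (F : I -> J -> R) :
  \sum_(x : {ffun I -> J}) \prod_i F i (x i) = \prod_i \sum_j F i j.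
Proof. by rewrite bigA_distr_bigA. Qed.

Lemma bernoulli_ineq (n : nat) (x : R) : 0 <= x <= 1 ->
  1 - n%:R * x <= (1 - x) ^+ n.
Proof.
move=> /andP[x0 x1]; elim: n => [|n IH]; first by rewrite mul0r subr0 expr0.
rewrite exprS; apply: (@le_trans _ _ ((1 - x) * (1 - n%:R * x))).
  have : 0 <= n%:R * x ^+ 2 by rewrite mulr_ge0// sqr_ge0.
  rewrite -natr1; lra.
by apply: ler_wpM2l => //; lra.
Qed.

Lemma dH2_affinity (k : nat) (p q : 'I_k -> R) : is_dist p -> is_dist q ->
  \sum_i Num.sqrt (p i * q i) = 1 - dH2 p q / 2.
Proof.
move=> [p0 p1] [q0 q1].
have -> : dH2 p q = 2 - 2 * \sum_i Num.sqrt (p i * q i).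
  rewrite /dH2 (eq_bigr (fun i => p i + q i - 2 * Num.sqrt (p i * q i))).
    by rewrite sumrB big_split/= p1 q1 mulr_sumr; congr (_ - _); ring.
  by move=> i _; exact: h2E.
lra.
Qed.

Lemma dH2_ge0 (k : nat) (p q : 'I_k -> R) : 0 <= dH2 p q.
Proof. by apply: sumr_ge0 => i _; exact: sqr_ge0. Qed.

Lemma dH2_le2 (k : nat) (p q : 'I_k -> R) : is_dist p -> is_dist q ->
  dH2 p q <= 2.
Proof.
move=> dp dq; have := dH2_affinity _ _ _ dp dq.
have : 0 <= \sum_i Num.sqrt (p i * q i) by apply: sumr_ge0 => i _; exact: sqrtr_ge0.
lra.
Qed.

Lemma dH2_gt0 (k : nat) (p q : 'I_k -> R) : is_dist p -> is_dist q ->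
  p <> q -> 0 < dH2 p q.
Proof.
move=> [p0 _] [q0 _] pq; rewrite lt_neqAle dH2_ge0 andbT eq_sym; apply/eqP => h.
apply: pq; apply/funext => i; move/eqP: h.
rewrite /dH2 psumr_eq0; last by move=> j _; exact: sqr_ge0.
move=> /allP/(_ i); rewrite mem_index_enum => /(_ isT) /=.
rewrite sqrf_eq0 subr_eq0 eqr_sqrt// => /eqP.
exact.
Qed.

Lemma dTV_ge_dH2 (k : nat) (p q : 'I_k -> R) : is_dist p -> is_dist q ->
  dH2 p q <= 2 * dTV p q.
Proof.
move=> [p0 _] [q0 _]; rewrite /dTV mulrA divff// mul1r.
by apply: ler_sum => i _; exact: h2_le_norm.
Qed.

Lemma sqrt_prod (I : finType) (f : I -> R) : (forall i, 0 <= f i) ->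
  Num.sqrt (\prod_i f i) = \prod_i Num.sqrt (f i).
Proof.
(* Nonnegativity is carried along the induction, since [sqrtrM] needs it. *)
move=> f0; apply: (@proj2 (0 <= \prod_i f i)).
elim/big_ind2: _ => [|x1 x2 y1 y2 [x10 <-] [y10 <-]|i _].
- by rewrite sqrtr1; split.
- by rewrite sqrtrM// mulr_ge0.
- by split.
Qed.

(** The Bhattacharyya coefficient is multiplicative over independent coordinates. *)
Lemma affinity_prod (k n : nat) (p q : 'I_k -> R) : is_dist p -> is_dist q ->
  \sum_(x : {ffun 'I_n -> 'I_k})
    Num.sqrt ((\prod_i p (x i)) * (\prod_i q (x i))) = (1 - dH2 p q / 2) ^+ n.
Proof.
move=> dp dq; have [p0 _] := dp; have [q0 _] := dq.
rewrite -dH2_affinity// -[in RHS](card_ord n) -prodr_const.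
rewrite -(@sum_prod_ffun _ _ (fun _ i => Num.sqrt (p i * q i))).
apply: eq_bigr => x _; rewrite -big_split/= sqrt_prod// => i.
by rewrite mulr_ge0.
Qed.

Lemma min_le_sqrt (a b : R) : 0 <= a -> 0 <= b -> Num.min a b <= Num.sqrt (a * b).
Proof.
move=> a0 b0; rewrite -[leLHS]ger0_norm ?le_min ?a0// -sqrtr_sqr ler_wsqrtr//.
rewrite expr2; apply: ler_pM; rewrite ?le_min ?a0 ?b0//.
  by rewrite ge_min lexx.
by rewrite ge_min lexx orbT.
Qed.

(* AM-GM for [3 min a b] and [max a b / 3]; the weight is close to the optimal one
   when the minima sum to [1/5] and the maxima to at most [2]. *)
Lemma sqrt_le_min (a b : R) : 0 <= a -> 0 <= b ->
  2 * Num.sqrt (a * b) <= 3 * Num.min a b + 3^-1 * (a + b - Num.min a b).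
Proof.
wlog ab : a b / a <= b => [W|].
  move=> a0 b0; have /orP[h|h] := le_total a b; first exact: W.
  by rewrite (mulrC a) (minC a) (addrC a); exact: W.
move=> a0 b0; rewrite min_l// sqrtrM//.
have := sqr_sqrtr a0; have := sqr_sqrtr b0.
move: (Num.sqrt a) (Num.sqrt b) => x y <- <-; have := sqr_ge0 (3 * x - y); lra.
Qed.

End Product.

(** * Tests *)

Section LikelihoodRatioTest.
Context {R : realType} {k m : nat}.
Implicit Types (p q : 'I_k -> R) (T : 'I_k -> 'I_m -> R).

Definition out p T (y : 'I_m) : R := \sum_x p x * T x y.

Lemma is_channel_finE T :
  is_channel T <-> (forall x y, 0 <= T x y) /\ (forall x, \sum_y T x y = 1).
Proof.
have E x : (forall y, 0 <= T x y) ->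
    (\esum_(y in [set: 'I_m]) (T x y)%:E = (\sum_y T x y)%:E)%E.
  by move=> T0; rewrite -esum_finType//; congr esum; apply/seteqP; split.
split=> -[T0 T1]; split=> // x; have := T1 x; rewrite E//; first by case.
by move=> ->.
Qed.

Lemma out_dist p T : is_dist p -> is_channel T -> is_dist (out p T).
Proof.
move=> [p0 p1] /is_channel_finE[T0 T1]; split.
  by move=> y; apply: sumr_ge0 => x _; rewrite mulr_ge0.
rewrite exchange_big/= -p1; apply: eq_bigr => x _.
by rewrite -mulr_sumr T1 mulr1.
Qed.

Lemma output_prob_finE n p T (A : pred {ffun 'I_n -> 'I_m}) :
  is_dist p -> is_channel T ->
  output_prob p (fun=> T) [set y | A y] =
    (\sum_(y | A y) \prod_i out p T (y i))%:E.
Proof.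
move=> [p0 p1] /is_channel_finE[T0 T1].
rewrite /output_prob esum_finType; last first.
  move=> y; apply: sumr_ge0 => x _; apply: prodr_ge0 => i _.
  by rewrite mulr_ge0.
congr (_%:E); apply: eq_bigr => y _.
by rewrite (@sum_prod_ffun _ _ _ (fun i x => p x * T x (y i))).
Qed.

(** The two errors of this test add up to $\sum\min(P,Q)$, which is at most the affinity $(1-h/2)^n$
    of the product laws. *)
Lemma likelihood_ratio_test n p q T : is_dist p -> is_dist q -> is_channel T ->
  18 <= n%:R * dH2 (out p T) (out q T) ->
  exists phi : {ffun 'I_n -> 'I_m} -> bool, succeeds p q (fun=> T) phi.
Proof.
move=> dp dq cT n18.
have dp' := out_dist p T dp cT; have dq' := out_dist q T dq cT.
have [op0 _] := dp'; have [oq0 _] := dq'.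
set P := fun y : {ffun 'I_n -> 'I_m} => \prod_i out p T (y i).
set Q := fun y : {ffun 'I_n -> 'I_m} => \prod_i out q T (y i).
have P0 y : 0 <= P y by apply: prodr_ge0.
have Q0 y : 0 <= Q y by apply: prodr_ge0.
exists (fun y => Q y <= P y).
rewrite /succeeds !output_prob_finE// -EFinD lee_fin.
rewrite [X in X + _]big_mkcond [X in _ + X]big_mkcond -big_split/=.
apply: (@le_trans _ _ (\sum_y Num.sqrt (P y * Q y))).
  apply: ler_sum => y _; apply: le_trans (min_le_sqrt _ _ (P0 y) (Q0 y)).
  have [h|h] := boolP (Q y <= P y); rewrite ?addr0 ?add0r /=.
    by rewrite le_min h lexx.
  by rewrite le_min lexx ltW// ltNge.
rewrite affinity_prod//.
have h2 := dH2_le2 _ _ _ dp' dq'.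
move: (dH2 _ _) n18 h2 => h n18 h2.
(* The constant 18 makes this at most $e^{-9}$, and $e^9\ge1+9=10$. *)
apply: (@le_trans _ _ (expR (- (h / 2)) ^+ n)).
  rewrite lerXn2r ?nnegrE ?expR_ge0//; first lra.
  by rewrite expR_ge1Dx.
rewrite -expRM_natl mulrN expRN lef_pV2 ?posrE ?expR_gt0//.
apply: le_trans (expR_ge1Dx _); lra.
Qed.

End LikelihoodRatioTest.

(** * Finite outputs seen as natural numbers *)

Section NatOutputs.
Context {R : realType} {k m : nat}.
Implicit Types (p q : 'I_k -> R) (T : 'I_k -> 'I_m.+1 -> R).

Definition nat_channel T (x : 'I_k) (y : nat) : R :=
  if insub y is Some j then T x j else 0.

Lemma nat_channelE T x (y : 'I_m.+1) : nat_channel T x y = T x y.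
Proof. by rewrite /nat_channel valK. Qed.

Lemma nat_channel_out T x (y : nat) : ~ range (@nat_of_ord m.+1) y ->
  nat_channel T x y = 0.
Proof.
move=> ny; rewrite /nat_channel; case: insubP => // j _ jy.
by case: ny; exists j.
Qed.

Lemma is_channel_nat T : is_channel T -> is_channel (nat_channel T).
Proof.
move=> [T0 T1]; split.
  by move=> x y; rewrite /nat_channel; case: insub => //=.
move=> x; rewrite -(T1 x) (@esum_pull _ _ _ (@nat_of_ord m.+1)).
- by rewrite preimage_setT; apply: eq_esum => y _; rewrite nat_channelE.
- exact: val_inj.
- by move=> y /nat_channel_out ->.
Qed.

Lemma LDP_nat eps T : LDP eps T -> LDP eps (nat_channel T).
Proof.
move=> ldp x x' y; rewrite /nat_channel; case: insub => [j|]; first exact: ldp.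
by rewrite mulr0.
Qed.

(** An output sequence that does not come from ['I_m.+1] has a coordinate above $m$, whose factor
    vanishes. *)
Lemma output_prob_nat n p T (A : set {ffun 'I_n -> nat}) :
  output_prob p (fun=> nat_channel T) A =
  output_prob p (fun=> T)
    [set y : {ffun 'I_n -> 'I_m.+1} | A [ffun i => y i : nat]].
Proof.
rewrite /output_prob.
rewrite (@esum_pull _ _ _ (fun z : {ffun 'I_n -> 'I_m.+1} => [ffun i => z i : nat])).
- apply: eq_esum => y _; congr (_%:E); apply: eq_bigr => x _.
  by apply: eq_bigr => i _; rewrite ffunE nat_channelE.
- move=> y z /ffunP yz; apply/ffunP => i; apply: val_inj.
  by have := yz i; rewrite !ffunE.
- move=> y ny; congr (_%:E); apply: big1 => x _.
  suff [i yi] : exists i, (m < y i)%N.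
    rewrite (bigD1 i)//= nat_channel_out ?mulr0 ?mul0r// => -[j _ jy].
    by move: yi; rewrite -jy ltnNge -ltnS ltn_ord.
  apply: contrapT => /forallNP le_m; apply: ny.
  exists [ffun i => inord (y i)] => //; apply/ffunP => i.
  by rewrite !ffunE inordK// ltnS leqNgt; apply/negP.
Qed.

Lemma testable_nat n p q T (allowed : set ('I_k -> nat -> R))
    (phi : {ffun 'I_n -> 'I_m.+1} -> bool) :
  is_channel T -> allowed (nat_channel T) -> succeeds p q (fun=> T) phi ->
  testable p q allowed n.
Proof.
move=> cT aT ok; exists (fun=> nat_channel T); split.
  by move=> _; split=> //; exact: is_channel_nat.
exists (fun y => phi [ffun i => inord (y i)]).
rewrite /succeeds !output_prob_nat; move: ok; rewrite /succeeds.
have E (b : bool) : [set y : {ffun 'I_n -> 'I_m.+1} | phi y != b] =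
    [set y : {ffun 'I_n -> 'I_m.+1} | [set y0 : {ffun 'I_n -> nat} |
      phi [ffun i => inord (y0 i)] != b] [ffun i => y i : nat]].
  apply/seteqP; split=> y /=; rewrite (_ : [ffun i => _] = y)//;
    by apply/ffunP => i; rewrite !ffunE inord_val.
by rewrite !E.
Qed.

End NatOutputs.

(** * Lower bound for tests without privacy *)

Section LowerBound.
Context {R : realType} {k : nat}.
Implicit Types (p q : 'I_k -> R).

Lemma channel_partial_sum (T : 'I_k -> nat -> R) x (e : R) : is_channel T ->
  0 < e -> exists M, forall M', (M <= M')%N -> 1 - e <= \sum_(y < M') T x y.
Proof.
move=> [T0 T1] e0.
suff [M HM] : exists M, 1 - e <= \sum_(y < M) T x y.
  exists M => M' le_M; apply: le_trans HM _.
  rewrite -!(big_mkord xpredT (T x)) (big_cat_nat _ le_M)//= lerDl.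
  exact: sumr_ge0.
apply: contrapT => /forallNP H; have := T1 x.
rewrite -nneseries_esumT; last by move=> y; rewrite lee_fin.
suff : (\sum_(0 <= y <oo) (T x y)%:E <= (1 - e)%:E)%E.
  by move=> /[swap] ->; rewrite lee_fin; lra.
apply: lime_le; first by apply: is_cvg_nneseries => y _ _; rewrite lee_fin.
apply: nearW => M; rewrite sumEFin lee_fin big_mkord.
by have /negP := H M; rewrite -ltNge => /ltW.
Qed.

(** This reduces countable outputs to finite sums. Each coordinate may lose $1/(2(n+1))$, so by
    Bernoulli's inequality the product keeps at least 1/2; one box serves all $x$ because there are
    finitely many pairs (user, letter). *)
Lemma boxes_catch_half n (T : 'I_n -> 'I_k -> nat -> R) :
  (forall i, is_channel (T i)) -> exists M, forall x : {ffun 'I_n -> 'I_k},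
    2^-1 <= \sum_(z : {ffun 'I_n -> 'I_M}) \prod_i T i (x i) (z i).
Proof.
move=> cT; have e0 : 0 < (2 * n.+1%:R)^-1 :> R by rewrite invr_gt0 mulr_gt0.
have /choice[M0 HM] (ix : 'I_n * 'I_k) : exists M, forall M', (M <= M')%N ->
    1 - (2 * n.+1%:R)^-1 <= \sum_(y < M') T ix.1 ix.2 y.
  exact: channel_partial_sum.
exists (\max_ix M0 ix)%N => x.
rewrite (@sum_prod_ffun _ _ _ (fun i (y : 'I__) => T i (x i) y)).
apply: (@le_trans _ _ (\prod_(i < n) (1 - (2 * n.+1%:R)^-1))).
  rewrite prodr_const card_ord; apply: le_trans (bernoulli_ineq _ _ _).
    rewrite invfM mulrCA -[leLHS]mulr1 lerBrDr -lerBrDl.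
    have -> : 1 - 2^-1 * 1 = 2^-1 * 1 :> R by lra.
    by rewrite ler_pM2l ?invr_gt0// ler_pdivrMr ?mul1r ?ler_nat.
  rewrite ltW//= invf_le1 ?mulr_gt0// -natrM ler1n; lia.
apply: ler_prod => i _; rewrite (HM (i, x i) _ (leq_bigmax _)) andbT.
rewrite subr_ge0 invf_le1 ?mulr_gt0// -natrM ler1n; lia.
Qed.

Lemma output_prob_ge n M p (T : 'I_n -> 'I_k -> nat -> R)
    (A : pred {ffun 'I_n -> nat}) : (forall i, 0 <= p i) ->
  (forall i, is_channel (T i)) ->
  ((\sum_(z : {ffun 'I_n -> 'I_M} | A [ffun i => z i : nat])
     \sum_(x : {ffun 'I_n -> 'I_k}) (\prod_i p (x i)) * \prod_i T i (x i) (z i))%:E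
   <= output_prob p T [set y | A y])%E.
Proof.
move=> p0 cT; rewrite /output_prob.
apply: le_trans (@esum_image_le _ _ _
  (fun z : {ffun 'I_n -> 'I_M} => [ffun i => z i : nat]) _ _ _ _).
- rewrite lee_fin le_eqVlt; apply/orP; left; apply/eqP.
  apply: eq_bigr => z _; apply: eq_bigr => x _; rewrite -big_split/=.
  by apply: eq_bigr => i _; rewrite ffunE.
- move=> y z /ffunP yz; apply/ffunP => i; apply: val_inj.
  by have := yz i; rewrite !ffunE.
- move=> y; apply: sumr_ge0 => x _; apply: prodr_ge0 => i _.
  by have [T0 _] := cT i; rewrite mulr_ge0.
Qed.

(** Data processing: the kernel from $x$ to the outputs is the same under both laws, so whatever the
    answer at $z$, its error is at least the kernel average of $\min(P,Q)$. A box keeps half of each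
    kernel, which turns 1/10 into 1/5. *)
Lemma sum_min_le n p q (T : 'I_n -> 'I_k -> nat -> R) phi :
  is_dist p -> is_dist q -> (forall i, is_channel (T i)) ->
  succeeds p q T phi ->
  \sum_(x : {ffun 'I_n -> 'I_k}) Num.min (\prod_i p (x i)) (\prod_i q (x i))
    <= 5^-1.
Proof.
move=> [p0 p1] [q0 q1] cT ok; have [M HM] := boxes_catch_half _ _ cT.
have P0 (x : {ffun 'I_n -> 'I_k}) : 0 <= \prod_i p (x i) by apply: prodr_ge0.
have Q0 (x : {ffun 'I_n -> 'I_k}) : 0 <= \prod_i q (x i) by apply: prodr_ge0.
have K0 (x : {ffun 'I_n -> 'I_k}) (z : {ffun 'I_n -> 'I_M}) :
    0 <= \prod_i T i (x i) (z i).
  by apply: prodr_ge0 => i _; have [T0 _] := cT i.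
have := le_trans (leeD (@output_prob_ge _ M p T (fun y => phi y != true) p0 cT)
  (@output_prob_ge _ M q T (fun y => phi y != false) q0 cT)) ok.
rewrite -EFinD lee_fin => H.
suff : 2^-1 * \sum_(x : {ffun 'I_n -> 'I_k})
    Num.min (\prod_i p (x i)) (\prod_i q (x i)) <= 10^-1 by lra.
apply: le_trans H.
rewrite [X in X + _]big_mkcond [X in _ + X]big_mkcond -big_split/=.
apply: (@le_trans _ _ (\sum_(z : {ffun 'I_n -> 'I_M})
  \sum_(x : {ffun 'I_n -> 'I_k}) Num.min (\prod_i p (x i)) (\prod_i q (x i)) *
    \prod_i T i (x i) (z i))).
  rewrite exchange_big/= mulr_sumr; apply: ler_sum => x _.
  by rewrite -mulr_sumr mulrC ler_wpM2l// le_min P0 Q0.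
apply: ler_sum => z _; case: (phi _) => /=; rewrite ?addr0 ?add0r;
  apply: ler_sum => x _; apply: ler_wpM2r => //.
- by rewrite ge_min lexx orbT.
- by rewrite ge_min lexx.
Qed.

(** Summing [sqrt_le_min] with $\sum\min\le1/5$ bounds twice the affinity by $2/3+8/15=6/5$.
    Bernoulli's inequality then gives $1-n\,d_h^2/2\le3/5$, hence more than the stated constant. *)
Lemma testable_lower n p q : is_dist p -> is_dist q ->
  testable p q setT n -> 11 / 15 <= n%:R * dH2 p q.
Proof.
move=> dp dq [T [cT [phi ok]]]; have {}cT i := (cT i).1.
have := sum_min_le _ _ _ _ _ dp dq cT ok.
have [p0 p1] := dp; have [q0 q1] := dq.
have P0 (x : {ffun 'I_n -> 'I_k}) : 0 <= \prod_i p (x i) by apply: prodr_ge0.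
have Q0 (x : {ffun 'I_n -> 'I_k}) : 0 <= \prod_i q (x i) by apply: prodr_ge0.
have total f : \sum_(i < k) f i = 1 ->
    \sum_(x : {ffun 'I_n -> 'I_k}) \prod_i f (x i) = 1 :> R.
  by move=> f1; rewrite (@sum_prod_ffun _ _ _ (fun=> f)) f1 prodr_const expr1n.
have : 2 * \sum_(x : {ffun 'I_n -> 'I_k})
      Num.sqrt ((\prod_i p (x i)) * (\prod_i q (x i))) <=
    3 * (\sum_(x : {ffun 'I_n -> 'I_k}) Num.min (\prod_i p (x i)) (\prod_i q (x i)))
    + 3^-1 * (2 - \sum_(x : {ffun 'I_n -> 'I_k})
       Num.min (\prod_i p (x i)) (\prod_i q (x i))).
  rewrite (_ : 2 - _ = \sum_(x : {ffun 'I_n -> 'I_k}) (\prod_i p (x i) +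
     \prod_i q (x i) - Num.min (\prod_i p (x i)) (\prod_i q (x i)))); last first.
    by rewrite sumrB big_split/= !total.
  rewrite !mulr_sumr -big_split/=; apply: ler_sum => x _; exact: sqrt_le_min.
rewrite affinity_prod//.
have : 1 - n%:R * (dH2 p q / 2) <= (1 - dH2 p q / 2) ^+ n.
  apply: bernoulli_ineq; have := dH2_le2 _ _ _ dp dq; have := dH2_ge0 _ p q; lra.
move: (\sum_(x : {ffun _ -> _}) _) ((_ - _) ^+ n) => S B; lra.
Qed.

End LowerBound.

(** * Rates *)

Section Rates.
Context {R : realType} {k : nat}.
Variables (p q : 'I_k -> R) (dp : is_dist p) (dq : is_dist q).

Lemma out_rr eps (S : pred 'I_k) (f : 'I_k -> R) (y : 'I_2) : is_dist f ->
  out f (rr_channel eps S) y =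
    if y == 0%N :> nat
    then rr_lo (expR eps) + (rr_hi (expR eps) - rr_lo (expR eps)) * mass f S
    else rr_hi (expR eps) - (rr_hi (expR eps) - rr_lo (expR eps)) * mass f S.
Proof.
move=> [f0 f1]; rewrite /out (bigID S)/=.
set a := if y == 0%N :> nat then rr_hi (expR eps) else rr_lo (expR eps).
set b := if y == 0%N :> nat then rr_lo (expR eps) else rr_hi (expR eps).
rewrite (eq_bigr (fun x => f x * a)); last first.
  by move=> x Sx; rewrite /rr_channel Sx /a; case: (_ == 0%N).
rewrite [X in _ + X](eq_bigr (fun x => f x * b)); last first.
  by move=> x Sx; rewrite /rr_channel (negbTE Sx) /b; case: (_ == 0%N).
rewrite -!mulr_suml.
have fc : \sum_(i | ~~ S i) f i = _ := massC f S f1.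
by rewrite fc -/(mass f S) /a /b; case: ifP => _; ring.
Qed.

Lemma dH2_out_rr eps c :
  dH2 (out p (rr_channel eps (superlevel p q c)))
      (out q (rr_channel eps (superlevel p q c))) =
  threshold_score p q (expR eps) c.
Proof. by rewrite /dH2 !big_ord_recl big_ord0 addr0 !out_rr. Qed.

Lemma rr_channel_is_channel eps (S : pred 'I_k) :
  is_channel (rr_channel eps S : _ -> _ -> R).
Proof.
apply/is_channel_finE; split.
  move=> x y; rewrite /rr_channel.
  by case: ifP => _; rewrite ltW// ?rr_hi_gt0 ?rr_lo_gt0 ?expR_gt0.
move=> x; rewrite !big_ord_recl big_ord0 addr0 /rr_channel /=.
by case: (S x) => /=; rewrite ?rr_add ?expR_gt0// addrC rr_add ?expR_gt0.
Qed.

Lemma rr_channel_LDP eps (S : pred 'I_k) : 0 < eps ->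
  LDP eps (rr_channel eps S : _ -> _ -> R).
Proof.
move=> eps0 x x' y; have E0 := expR_gt0 eps.
have E1 : 1 < expR eps by rewrite expR_gt1.
have l0 := rr_lo_gt0 _ E0; have h0 := rr_hi_gt0 _ E0; have hE := rr_hiE _ E0.
have grow z : 0 < z -> z <= expR eps * z by move=> z0; rewrite ler_pMl// ltW.
rewrite /rr_channel; case: ifP => _; case: ifP => _; rewrite ?grow//.
  by rewrite hE.
by apply: le_trans (grow _ h0); rewrite hE grow.
Qed.

Lemma ldp_rate_ge eps M : p <> q -> 0 < eps -> 0 <= M ->
  (forall j, threshold_score p q (expR eps) (tilt p q j) <= M) ->
  0 < M /\ M^-1 <= 72 * ldp_rate p q (log_factor p q) eps.
Proof.
move=> pq eps0 M0 HM; have h0 := dH2_gt0 _ _ _ dp dq pq.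
have tv0 : 0 < dTV p q by have := dTV_ge_dH2 _ _ _ dp dq; lra.
have E0 := expR_gt0 eps; have a0 := log_factor_gt0 p q.
have E1 : 1 + eps <= expR eps by exact: expR_ge1Dx.
have Htv := best_threshold_tv p q (expR eps) M dp dq _ M0 HM.
have {}Htv : ((rr_hi (expR eps) - rr_lo (expR eps)) * dTV p q) ^+ 2 <= 4 * M.
  by apply: Htv; lra.
(* As $E\ge1+d$, $(E-1)/(E+1)\ge d/(2+d)\ge d/3$. It is used with $d=\epsilon$ when $\epsilon\le1$
   and $d=1$ otherwise. *)
have s_ge (d : R) : 0 < d -> d <= 1 -> d <= eps ->
    d / 3 <= rr_hi (expR eps) - rr_lo (expR eps).
  move=> d0 d1 de; rewrite /rr_hi /rr_lo -mulrBl ler_pdivlMr; last lra.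
  nra.
have inv_le (x : R) : 0 < x -> x <= 72 * M -> 0 < M /\ M^-1 <= 72 * x^-1.
  move=> x0 xM; have M1 : 0 < M by lra.
  split=> //; rewrite -[leLHS]mul1r ler_pdivrMr// -mulrA (mulrC _ M) mulrCA mulrA.
  by rewrite ler_pdivlMr// mul1r mulrC.
have tv_le (d : R) : 0 < d -> d <= 1 -> d <= eps -> (d * dTV p q) ^+ 2 <= 72 * M.
  move=> d0 d1 de; have := s_ge d d0 d1 de.
  set s := rr_hi _ - _ in Htv * => ds.
  have : (d / 3 * dTV p q) ^+ 2 <= (s * dTV p q) ^+ 2.
    have d3 : 0 <= d / 3 by lra.
    have s0 : 0 <= s by lra.
    have tv0' := ltW tv0.
    apply: lerXn2r; rewrite ?nnegrE; [exact: mulr_ge0|exact: mulr_ge0|].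
    exact: ler_wpM2r.
  rewrite !exprMn in Htv *; lra.
rewrite /ldp_rate; case: (leP eps 1) => eps1.
  have [|M1 HM1] := inv_le _ _ (tv_le eps eps0 eps1 (lexx _)).
    by rewrite exprn_gt0// mulr_gt0.
  by split=> //; rewrite -exprMn mul1r.
rewrite ltr_expR eps1 /=.
have E2 : 2 <= expR eps by lra.
have Hh := best_threshold_hellinger p q (expR eps) M dp dq E2 M0 h0 HM.
set B := dH2 p q / log_factor p q in Hh.
have B0 : 0 < B by rewrite divr_gt0.
have [|M1 Mtv] := inv_le _ _ (tv_le 1 ltr01 (lexx _) (ltW eps1)).
  by rewrite exprn_gt0// mul1r.
(* The case boundary of the rate is exactly where the two terms $B$ and $e^\epsilon B^2$ of the
   minimum cross. *)
split=> //; have BE : (expR eps <= log_factor p q / dH2 p q) = (expR eps * B <= 1).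
  by rewrite ler_pdivlMr// /B mulrA ler_pdivrMr// mul1r.
rewrite BE; case: (leP (expR eps * B) 1) => EB.
  have EBB : expR eps * B ^+ 2 <= B.
    by rewrite expr2 mulrA -[leRHS]mul1r ler_wpM2r// ltW.
  rewrite min_r// in Hh.
  rewrite -ler_pdivrMl// le_min !ler_pdivrMl//; apply/andP; split.
    by move: Mtv; rewrite !mul1r.
  have [|_] := inv_le _ _ Hh; first by rewrite mulr_gt0// exprn_gt0.
  by rewrite /B expr_div_n mulrA invf_div.
have EBB : B <= expR eps * B ^+ 2.
  by rewrite expr2 mulrA -[leLHS]mul1r ler_wpM2r// ltW.
rewrite min_l// in Hh; have [_] := inv_le _ B0 Hh.
by rewrite /B invf_div.
Qed.

(** Rounding $18/M$ up to an integer adds at most $1\le2/M$, because the score $M$ is at most 2. *)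
Lemma achieves_rr eps c : 0 < threshold_score p q (expR eps) c ->
  achieves p q (rr_channel eps (superlevel p q c))
    (20 * (threshold_score p q (expR eps) c)^-1).
Proof.
move=> M0; have cT := rr_channel_is_channel eps (superlevel p q c).
have M2 : threshold_score p q (expR eps) c <= 2.
  by rewrite -dH2_out_rr dH2_le2//; exact: out_dist.
have LR := likelihood_ratio_test _ p q _ dp dq cT.
rewrite dH2_out_rr in LR; move: (threshold_score _ _ _ _) M0 M2 LR => M M0 M2 LR.
have [n [lo hi]] : exists n : nat, n%:R <= 18 * M^-1 /\ 18 * M^-1 < n.+1%:R.
  exists (Num.truncn (18 * M^-1)); apply/andP/truncn_itv.
  by rewrite mulr_ge0// invr_ge0 ltW.
have MM : M * M^-1 = 1 by rewrite mulfV// gt_eqF.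
have I2 : 2^-1 <= M^-1 by rewrite lef_pV2 ?posrE.
have [|phi ok] := LR n.+1.
  have := ltW hi; rewrite -(ler_pM2r M0); lra.
exists n.+1, phi; split=> //; rewrite -natr1; lra.
Qed.

Lemma sample_complexity_le (allowed : set ('I_k -> nat -> R)) n :
  testable p q allowed n ->
  exists2 m, is_sample_complexity p q allowed m & (m <= n)%N.
Proof.
move=> tn; have ex : exists m, `[< testable p q allowed m >] by exists n; exact/asboolP.
exists (ex_minn ex); case: ex_minnP => m /asboolP tm min.
  by split=> // m' /asboolP/min.
exact/min/asboolP.
Qed.

Lemma testable_allow_all (allowed : set ('I_k -> nat -> R)) n :
  testable p q allowed n -> testable p q setT n.
Proof.
move=> [T [cT [phi ok]]]; exists T; split; last by exists phi.
by move=> i; split=> //; exact: (cT i).1.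
Qed.

(** The left side has the form in which [ldp_rate] unfolds at $\epsilon=1$. *)
Lemma inv_dTV_le : p <> q -> 1 / (1 ^+ 2 * dTV p q ^+ 2) <= 4 * (1 / dH2 p q) ^+ 2.
Proof.
move=> pq; have h0 := dH2_gt0 _ _ _ dp dq pq.
have h2 := dTV_ge_dH2 _ _ _ dp dq; have tv0 : 0 < dTV p q by lra.
have -> : 1 / (1 ^+ 2 * dTV p q ^+ 2) = (dTV p q)^-1 ^+ 2.
  by rewrite expr1n !mul1r exprVn.
have -> : 4 * (1 / dH2 p q) ^+ 2 = (2 * (1 / dH2 p q)) ^+ 2 by ring.
apply: lerXn2r; rewrite ?nnegrE.
- by rewrite invr_ge0 ltW.
- by rewrite mulr_ge0// divr_ge0// ltW.
- by rewrite mulrA mulr1 ler_pdivlMr// mulrC ler_pdivrMr.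
Qed.

Lemma ln_sample_complexity N : p <> q -> testable p q setT N ->
  N%:R <= 80 * 72 * (1 / dH2 p q) ^+ 2 ->
  ln (N%:R : R) <= 152 + 2 * ln (1 / dH2 p q) /\
  (dH2 p q <= 2^-1 ->
    2^-1 <= ln (1 / dH2 p q) /\ ln (1 / dH2 p q) <= 2 * ln (N%:R : R)).
Proof.
move=> pq /testable_lower-/(_ dp dq) lowN upN; have h0 := dH2_gt0 _ _ _ dp dq pq.
have ih0 : 0 < 1 / dH2 p q by rewrite divr_gt0.
have N0 : 0 < N%:R :> R.
  by rewrite ltr0n lt0n; apply/eqP => N0; move: lowN; rewrite N0 mul0r; lra.
split.
  have sq0 : 0 < (1 / dH2 p q) ^+ 2 by rewrite exprn_gt0.
  have c0 : 0 < 80 * 72 :> R by rewrite mulr_gt0.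
  apply: (@le_trans _ _ (ln (80 * 72 * (1 / dH2 p q) ^+ 2))).
    by rewrite ler_ln ?posrE// mulr_gt0.
  rewrite lnM ?posrE// (lnM (x := 80)) ?posrE// lnXn// mulr2n.
  (* The crude bound $\ln x<x$ yields $152=80+72$. *)
  have h80 : ln (80 : R) < 80 by exact: ln_sublinear.
  have h72 : ln (72 : R) < 72 by exact: ln_sublinear.
  lra.
move=> hhalf; have two_le : 2 <= 1 / dH2 p q.
  rewrite ler_pdivlMr//; lra.
split.
  rewrite -ler_expR lnK ?posrE//; apply: le_trans two_le.
  by have := @pow2_ge_expR R 1; rewrite expr1 mul1r.
(* $N\le1$ would force [dH2 p q] $\ge11/15>1/2$. With $N\ge2$, $N^2d_h^2\ge(11/15)N>1$, which is the
   claim after taking logarithms. *)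
have N2 : 2 <= N%:R :> R.
  rewrite ler_nat ltnNge -(ler_nat R); apply/negP => N1.
  have := ler_wpM2r (ltW h0) N1; lra.
rewrite mulr_natl -lnXn// ler_ln ?posrE ?exprn_gt0//.
rewrite ler_pdivrMr//.
have : N%:R * (11 / 15) <= N%:R * (N%:R * dH2 p q) by rewrite ler_wpM2l// ltW.
rewrite expr2; lra.
Qed.

End Rates.

(** As [dH2] ranges up to 2, [ln (1 / dH2 p q)] may be zero or negative; hence the comparison of
    logarithms with [lnp] in general, and with [ln] when [dH2 p q] is at most 1/2. *)
Theorem theorem1p9 (R : realType) :
  exists (C : R) (prog : cmd) (d : nat), 0 < C /\
  forall (k : nat) (p q : 'I_k -> R),
    is_dist p -> is_dist q -> p <> q ->
  exists (alpha : R) (N : nat),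
    [/\ 0 < alpha /\ alpha <= C * lnp (1 / dH2 p q),
        is_sample_complexity p q setT N,
        C^-1 * lnp (1 / dH2 p q) <= lnp (N%:R : R) <= C * lnp (1 / dH2 p q),
        (dH2 p q <= 2^-1 ->
           alpha <= C * ln (1 / dH2 p q) /\
           C^-1 * ln (1 / dH2 p q) <= ln (N%:R : R) <= C * ln (1 / dH2 p q)) &
        forall eps : R, 0 < eps ->
          (exists n : nat, is_sample_complexity p q (LDP eps) n /\
             n%:R <= C * ldp_rate p q alpha eps) /\
          (exists T : 'I_k -> 'I_2 -> R,
             [/\ is_channel T, LDP eps T,
                 achieves p q T (C * ldp_rate p q alpha eps) &
                 finds_channel prog p q eps T (d * k ^ d)%N])].
Proof.
(* The factor 20 comes from [achieves_rr] and 72 from [ldp_rate_ge]. *)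
exists (20 * 72), best_threshold_prog, 22%N; split; first by rewrite mulr_gt0.
move=> k p q dp dq pq; set C : R := 20 * 72.
have C400 : 400 <= C by rewrite /C; lra.
have C0 : 0 < C by lra.
have k0 : (0 < k)%N.
  case: k p q dp dq {pq} => // p q [_ p1] _; move: p1; rewrite big_ord0 => /eqP.
  by rewrite eq_sym oner_eq0.
have channel eps : 0 < eps -> exists T : 'I_k -> 'I_2 -> R,
    [/\ is_channel T, LDP eps T,
        achieves p q T (C * ldp_rate p q (log_factor p q) eps) &
        finds_channel best_threshold_prog p q eps T (22 * k ^ 22)%N].
  move=> eps0; have [c [best found]] := best_threshold_prog_correct p q eps k0.
  have [M0 HM] := ldp_rate_ge p q dp dq eps _ pq eps0 (score_ge0 _ _ _) best.
  exists (rr_channel eps (superlevel p q c)); split=> //.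
  - exact: rr_channel_is_channel.
  - exact: rr_channel_LDP.
  have [n [phi [le_n ok]]] := achieves_rr p q dp dq eps c M0.
  exists n, phi; split=> //; apply: le_trans le_n _.
  by rewrite /C -mulrA ler_pM2l.
have complexity eps : 0 < eps -> exists n, is_sample_complexity p q (LDP eps) n /\
    n%:R <= C * ldp_rate p q (log_factor p q) eps.
  move=> /channel[T [cT ldpT [n [phi [le_n ok]]] _]].
  have [m cm le_mn] := sample_complexity_le p q _ _
    (testable_nat n p q T (LDP eps) phi cT (LDP_nat _ _ ldpT) ok).
  by exists m; split=> //; apply: le_trans le_n; rewrite ler_nat.
(* A private test at $\epsilon=1$ is also a test without privacy; this bounds $N$ by a multiple of
   $1/d_h^4$. *)
have [n1 [[test_n1 _] le_n1]] := complexity 1 ltr01.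
have [N cN le_Nn1] := sample_complexity_le p q setT n1 (testable_allow_all _ _ _ _ test_n1).
have upN : N%:R <= 80 * 72 * (1 / dH2 p q) ^+ 2.
  apply: (@le_trans _ _ n1%:R); first by rewrite ler_nat.
  apply: le_trans le_n1 _; rewrite /ldp_rate lexx.
  have := inv_dTV_le p q dp dq pq; rewrite /C; lra.
have [lnN_le lnN_ge] := ln_sample_complexity p q dp dq N pq cN.1 upN.
have l1 := lnp_ge1 (1 / dH2 p q); have l2 := ln_le_lnp (1 / dH2 p q).
have n1' := lnp_ge1 (N%:R : R); have n2' := ln_le_lnp (N%:R : R).
exists (log_factor p q), N; split=> //.
- split; first exact: log_factor_gt0.
  rewrite /log_factor ler_wpM2r//; lra.
- rewrite ler_pdivrMl//; apply/andP; split.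
    have [h|h] := leP (dH2 p q) 2^-1.
      have [_ g] := lnN_ge h; rewrite {1}/lnp ge_max; apply/andP; split; nra.
    (* Here $1/d_h^2<2\le e$, so [lnp] takes its floor value 1. *)
    rewrite [lnp (1 / _)]max_l; first nra.
    have h0 := dH2_gt0 _ _ _ dp dq pq.
    rewrite -[1 in leRHS]expRK ler_ln ?posrE ?divr_gt0 ?expR_gt0//.
    apply: le_trans (expR_ge1Dx _); rewrite ler_pdivrMr//; lra.
  rewrite {1}/lnp ge_max; apply/andP; split; nra.
- move=> h; have [g1 g2] := lnN_ge h.
  rewrite ler_pdivrMl//; split; last by apply/andP; split; nra.
  rewrite /log_factor.
  have : lnp (1 / dH2 p q) <= 2 * ln (1 / dH2 p q).
    rewrite /lnp ge_max; apply/andP; split; lra.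
  nra.
- by move=> eps eps0; split; [exact: complexity|exact: channel].
Qed.
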